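(* Let $\mathcal{O}$ be an $n$-dimensional orbifold and let $\mathcal{P}_1,\mathcal{P}_2\subset\mathcal{O}$ be transverse full suborbifolds of dimension $k_1$, $k_2$, respectively. Then $\mathcal{P}_1\cap\mathcal{P}_2$ is a full suborbifold of $\mathcal{O}$ of dimension $k_1+k_2-n$.
   Context: Manifolds are Hausdorff, second countable, smooth, without boundary and of constant finite dimension (not necessarily connected). ''Submanifold'' means embedded submanifold. Full $H$-submanifolds: for a Lie group $G$ (possibly finite), a $G$-manifold is a manifold with a smooth left $G$-action. If $H\subset G$ is a closed subgroup and $M$ is a $G$-manifold, a full $H$-submanifold of $M$ is an $H$-invariant submanifold $N\subset M$ such that whenever $g\in G$ and $x\in N$ satisfy $gx\in N$, then $g\in H$. Orbifolds: let $X$ be a second countable Hausdorff space. An $n$-dimensional orbifold chart on $X$ is a quadruple $(U,\widetilde{U}/\Gamma,\pi)$ where $U\subset X$ is open, $\Gamma$ is a finite group, $\widetilde{U}$ is a connected $n$-dimensional manifold with a smooth effective $\Gamma$-action, and $\pi\colon\widetilde{U}\to U$ is a continuous $\Gamma$-invariant map inducing a homeomorphism $\widetilde{U}/\Gamma\to U$. An injection from a chart $(V,\widetilde{V}/\Delta,\phi)$ to a chart $(U,\widetilde{U}/\Gamma,\pi)$ with $V\subset U$ is a smooth embedding $\lambda\colon\widetilde{V}\to\widetilde{U}$ with $\pi\circ\lambda=\phi$. Two charts $(U_i,\widetilde{U}_i/\Gamma_i,\pi_i)$, $i=1,2$, are compatible in $p$ if there is a chart $(V,\widetilde{V}/\Delta,\phi)$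 with $p\in V\subset U_1\cap U_2$ and injections from it into both charts. An $n$-dimensional orbifold atlas on $X$ is a collection of $n$-dimensional orbifold charts whose sets $U_\alpha$ cover $X$ and such that any two of them are compatible in every point of $U_\alpha\cap U_\beta$; every atlas is contained in a unique maximal atlas. An (effective) orbifold is a space $X$ together with a maximal orbifold atlas; a chart of (or on) the orbifold is an element of this maximal atlas. The orbifold and its underlying space are denoted by the same symbol. Full suborbifolds: a subset $\mathcal{P}\subset\mathcal{O}$ is a full $k$-dimensional suborbifold if for every $p\in\mathcal{P}$ there are a chart $(U,\widetilde{U}/\Gamma,\pi)$ of $\mathcal{O}$, a subgroup $\Delta\subset\Gamma$ and a $k$-dimensional full $\Delta$-submanifold $\widetilde{V}\subset\widetilde{U}$, connected and closed in $\widetilde{U}$, such that $\pi(\widetilde{V})$ is an open neighborhood of $p$ in $\mathcal{P}$. The empty set is regarded as a full suborbifold of every (possibly negative) dimension. Transversality: two full suborbifolds $\mathcal{P}_1,\mathcal{P}_2\subset\mathcal{O}$ are transverse if for every $p\in\mathcal{P}_1\cap\mathcal{P}_2$ there is a chart $(U,\widetilde{U}/\Gamma,\pi)$ of $\mathcal{O}$ and, for each $i=1,2$, a subgroup $\Delta_i\subset\Gamma$ and a full $\Delta_i$-submanifold $\widetilde{V}_i$ of $\widetilde{U}$ such that $\pi(\widetilde{V}_i)$ is an open subset of $\mathcal{P}_i$ and such that $\widetilde{V}_1$, $\widetilde{V}_2$ are transverse submanifolds of $\widetilde{U}$ intersecting in some point of $\pi^{-1}(p)$. *)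

(* Defs.v *)
From HB Require Import structures.
From mathcomp Require Import all_boot all_order all_algebra.
From mathcomp Require Import all_fingroup.
From mathcomp Require Import all_classical all_reals all_analysis.

Set Implicit Arguments.
Unset Strict Implicit.
Unset Printing Implicit Defensive.

Import Order.TTheory GRing.Theory Num.Theory.
Import numFieldNormedType.Exports.

Local Open Scope classical_set_scope.
Local Open Scope ring_scope.

(* Class C^k on an open set [A]: f is differentiable at the points of A and
   all its directional derivatives are of class C^(k-1). The value of f
   outside A is irrelevant. *)
Fixpoint class_C (R : realType) (V W : normedModType R) (k : nat) (A : set V)
    (f : V -> W) : Prop :=
  match k with
  | 0 => forall x, A x -> {for x, continuous f}
  | k'.+1 => (forall x, A x -> differentiable f x) /\
             (forall v : V, class_C k' A ('D_v f))
  end.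

Definition smooth_on (R : realType) (V W : normedModType R) (A : set V)
    (f : V -> W) : Prop := forall k, class_C k A f.

(* Homeomorphism from an open set [cdom] of M onto an open set [ccod] of R^n.
   Both directions are total functions with junk values outside. *)
Record coord_chart (R : realType) (n : nat) (M : topologicalType) :=
  CoordChart {
  cdom : set M;
  ccod : set 'rV[R]_n;
  cmap : M -> 'rV[R]_n;
  cinv : 'rV[R]_n -> M;
  cdom_open : open cdom;
  ccod_open : open ccod;
  cmap_cod : forall x, cdom x -> ccod (cmap x);
  cinv_dom : forall y, ccod y -> cdom (cinv y);
  cmapK : forall x, cdom x -> cinv (cmap x) = x;
  cinvK : forall y, ccod y -> cmap (cinv y) = y;
  cmap_continuous : forall x, cdom x -> {for x, continuous cmap};
  cinv_continuous : forall y, ccod y -> {for y, continuous cinv} }.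

Definition smooth_transition (R : realType) (n : nat) (M : topologicalType)
    (phi psi : coord_chart R n M) : Prop :=
  smooth_on [set y | ccod phi y /\ cdom psi (cinv phi y)]
            (cmap psi \o cinv phi).

(* The smooth structure is given by an atlas which need not be maximal; the
   maximal one consists of the charts satisfying [smooth_chart] below. *)
Record manifold (R : realType) (n : nat) := Manifold {
  mcarrier :> topologicalType;
  matlas : coord_chart R n mcarrier -> Prop;
  mhausdorff : hausdorff_space mcarrier;
  msecond_countable : @second_countable mcarrier;
  matlas_cover : forall x : mcarrier, exists2 phi, matlas phi & cdom phi x;
  matlas_smooth : forall phi psi, matlas phi -> matlas psi ->
    smooth_transition phi psi }.

Definition smooth_chart (R : realType) (n : nat) (M : manifold R n)
    (phi : coord_chart R n M) : Prop :=
  forall psi, matlas psi ->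
    smooth_transition phi psi /\ smooth_transition psi phi.

Definition smooth_map (R : realType) (m n : nat) (M : manifold R m)
    (N : manifold R n) (f : M -> N) : Prop :=
  continuous f /\
  forall (phi : coord_chart R m M) (psi : coord_chart R n N),
    matlas phi -> matlas psi ->
    smooth_on [set y | ccod phi y /\ cdom psi (f (cinv phi y))]
              (cmap psi \o f \o cinv phi).

Definition immersion (R : realType) (m n : nat) (M : manifold R m)
    (N : manifold R n) (f : M -> N) : Prop :=
  smooth_map f /\
  forall (x : M) (phi : coord_chart R m M) (psi : coord_chart R n N),
    matlas phi -> matlas psi -> cdom phi x -> cdom psi (f x) ->
    injective ('d (cmap psi \o f \o cinv phi) (cmap phi x)).

Definition smooth_embedding (R : realType) (m n : nat) (M : manifold R m)
    (N : manifold R n) (f : M -> N) : Prop :=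
  [/\ immersion f, injective f &
      forall W : set M, open W -> exists2 W' : set N, open W' & f @^-1` W' = W].

(* Embedded k-dimensional submanifolds, by slice charts: the chart phi maps
   N /\ cdom phi onto ccod phi /\ (R^k x 0). The condition k <= n is needed:
   for k > n the last clause would hold for every open N. *)
Definition submanifold (R : realType) (n : nat) (M : manifold R n) (k : nat)
    (N : set M) : Prop :=
  forall x, N x -> (k <= n)%N /\
    exists phi : coord_chart R n M,
      [/\ smooth_chart phi, cdom phi x &
          forall y, cdom phi y ->
            (N y <-> forall i : 'I_n, (k <= i)%N -> cmap phi y ord0 i = 0)].

(* T_x N as a subset of R^n = T_x M, read in the chart phi: the velocities at
   0 of the smooth curves in N through x. *)
Definition tangent_space (R : realType) (n : nat) (M : manifold R n)
    (N : set M) (phi : coord_chart R n M) (x : M) : set 'rV[R]_n :=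
  [set v | exists (c : R -> M) (e : R),
    [/\ 0 < e, c 0 = x,
        forall t, `|t| < e -> N (c t) /\ cdom phi (c t),
        smooth_on [set t : R | `|t| < e] (cmap phi \o c) &
        v = 'D_1 (cmap phi \o c) 0]].

Definition transverse_submanifolds (R : realType) (n : nat) (M : manifold R n)
    (N1 N2 : set M) : Prop :=
  forall (x : M) (phi : coord_chart R n M),
    N1 x -> N2 x -> matlas phi -> cdom phi x ->
    forall w : 'rV[R]_n, exists v1 v2,
      [/\ tangent_space N1 phi x v1, tangent_space N2 phi x v2 & w = v1 + v2].

Definition smooth_action (R : realType) (n : nat) (G : finGroupType)
    (M : manifold R n) (act : G -> M -> M) : Prop :=
  [/\ forall x, act 1%g x = x,
      forall g h x, act (g * h)%g x = act g (act h x) &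
      forall g, smooth_map (act g)].

Definition effective_action (G : finGroupType) (T : Type)
    (act : G -> T -> T) : Prop :=
  forall g, (forall x, act g x = x) -> g = 1%g.

Definition full_submanifold (R : realType) (n : nat) (G : finGroupType)
    (M : manifold R n) (act : G -> M -> M) (H : {group G}) (k : nat)
    (N : set M) : Prop :=
  [/\ submanifold k N,
      forall g x, g \in H -> N x -> N (act g x) &
      forall g x, N x -> N (act g x) -> g \in H].

(* Orbifold chart (U, U~/Gamma, pi) on X. The last three fields unfold that pi
   induces a homeomorphism U~/Gamma -> U: it is a bijection, and W in U is
   open iff its preimage in U~/Gamma is, i.e. (quotient topology) iff
   pi^-1(W) is open in U~. *)
Record orbifold_chart (R : realType) (n : nat) (X : topologicalType) :=
  OrbifoldChart {
  obase : set X;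
  ocover : manifold R n;
  ogroup : finGroupType;
  oact : ogroup -> ocover -> ocover;
  oproj : ocover -> X;
  obase_open : open obase;
  ocover_connected : connected [set: ocover];
  oact_smooth : smooth_action oact;
  oact_effective : effective_action oact;
  oproj_continuous : continuous oproj;
  oproj_invariant : forall g x, oproj (oact g x) = oproj x;
  oproj_onto : range oproj = obase;
  oproj_orbit : forall x y, oproj x = oproj y -> exists g, y = oact g x;
  oproj_quotient : forall W : set X, W `<=` obase ->
    (open W <-> open (oproj @^-1` W)) }.

Definition orbifold_injection (R : realType) (n : nat) (X : topologicalType)
    (c d : orbifold_chart R n X) (lambda : ocover c -> ocover d) : Prop :=
  [/\ obase c `<=` obase d, smooth_embedding lambda &
      forall x, oproj (lambda x) = oproj x].

Definition compatible_at (R : realType) (n : nat) (X : topologicalType)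
    (c1 c2 : orbifold_chart R n X) (p : X) : Prop :=
  exists c : orbifold_chart R n X,
    [/\ obase c p, obase c `<=` obase c1 `&` obase c2,
        exists lambda : ocover c -> ocover c1, orbifold_injection lambda &
        exists lambda : ocover c -> ocover c2, orbifold_injection lambda].

Definition orbifold_atlas (R : realType) (n : nat) (X : topologicalType)
    (A : orbifold_chart R n X -> Prop) : Prop :=
  (forall p, exists2 c, A c & obase c p) /\
  (forall c1 c2, A c1 -> A c2 ->
     forall p, obase c1 p -> obase c2 p -> compatible_at c1 c2 p).

Record orbifold (R : realType) (n : nat) := Orbifold {
  ospace :> topologicalType;
  oatlas : orbifold_chart R n ospace -> Prop;
  ohausdorff : hausdorff_space ospace;
  osecond_countable : @second_countable ospace;
  oatlasP : orbifold_atlas oatlas;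
  oatlas_maximal : forall A : orbifold_chart R n ospace -> Prop,
    orbifold_atlas A -> (forall c, oatlas c -> A c) ->
    forall c, A c -> oatlas c }.

Definition open_in (X : topologicalType) (P S : set X) : Prop :=
  exists2 W : set X, open W & S = P `&` W.

(* The dimension is an integer: for k < 0 only the empty set qualifies, and
   the empty set qualifies for every k. *)
Definition full_suborbifold (R : realType) (n : nat) (O : orbifold R n)
    (k : int) (P : set O) : Prop :=
  forall p, P p ->
    exists (c : orbifold_chart R n O) (D : {group ogroup c})
           (m : nat) (V : set (ocover c)),
      [/\ oatlas c, k = m%:Z,
          full_submanifold (@oact R n O c) D m V,
          connected V /\ closed V &
          open_in P (@oproj R n O c @` V) /\ (@oproj R n O c @` V) p].

Definition transverse_suborbifolds (R : realType) (n : nat) (O : orbifold R n)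
    (P1 P2 : set O) : Prop :=
  forall p, P1 p -> P2 p ->
    exists (c : orbifold_chart R n O) (D1 D2 : {group ogroup c})
           (m1 m2 : nat) (V1 V2 : set (ocover c)),
      [/\ oatlas c,
          full_submanifold (@oact R n O c) D1 m1 V1 /\
          full_submanifold (@oact R n O c) D2 m2 V2,
          open_in P1 (@oproj R n O c @` V1) /\
          open_in P2 (@oproj R n O c @` V2),
          transverse_submanifolds V1 V2 &
          exists x, [/\ V1 x, V2 x & oproj x = p]].

(* Main.v *)
Require Import Defs.
From HB Require Import structures.
From mathcomp Require Import all_boot all_order all_algebra.
From mathcomp Require Import all_fingroup.
From mathcomp Require Import all_classical all_reals all_analysis.
From mathcomp Require Import ring lra zify.

Set Implicit Arguments.
Unset Strict Implicit.
Unset Printing Implicit Defensive.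

Import Order.TTheory GRing.Theory Num.Theory.
Import numFieldNormedType.Exports.

Local Open Scope classical_set_scope.
Local Open Scope ring_scope.

(* Near a point of the preimage of P_i, any chart of O presents that preimage
   as the zero set of the last n - k_i components of a local diffeomorphism F_i:
   in the chart defining P_i the preimage is, near a point of the closed full
   submanifold, equal to that submanifold, since its other translates are
   closed and do not contain the point; the description is then transported
   through the compatibility injections, which are local diffeomorphisms. In
   the chart given by transversality the submanifolds V_i lie in these
   preimages, so the kernels of the relevant components of dF_1 and dF_2 span
   R^n; hence the two families of components are jointly independent and are
   the last components of one local diffeomorphism. In particular the
   dimensions of the V_i are never needed. In the resulting coordinates the
   preimage of the intersection is linear. The sublevel sets of the sum of the
   squared distances to x along the orbit of the stabilizer of x are small,
   invariant and, by strict differentiability, star-shaped in these coordinates;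
   so they are the covers of orbifold charts in which the preimage of the
   intersection is a closed connected full submanifold for the whole group. *)

(** * Neighborhoods *)

(** Coordinates adapted to both suborbifolds need not linearize the stabilizer of the point, so
    round balls in them are not invariant. Yet a chart needs a connected invariant cover, and the
    slice in it must be connected as well; one neighborhood has to be both invariant and
    star-shaped. Invariance is exact, since the stabilizer permutes the summands. Star-shapedness
    holds because the summand of the identity decreases along rays towards the center by an amount
    that absorbs the errors of all other summands. For the whole group of the new chart fullness is
    automatic, and invariance holds because the slice is an entire preimage.

    Two facts about restricted charts remain. They are effective, because an element that fixes an
    open set is trivial; this is proved by averaging over the powers of the element in coordinates.
    They belong to the maximal atlas, because adjoining one of them gives an atlas again,
    compatibility being obtained by shrinking once more.

    That [k1 + k2 - n] is nonnegative at a common point is a rank bound: [(n - m1) + (n - m2)]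
    independent linear forms live on an [n]-dimensional space. *)

Lemma near_open (V : topologicalType) (A : set V) x (P : V -> Prop) :
  open A -> A x -> (forall y, A y -> P y) -> \forall y \near x, P y.
Proof. by move=> oA Ax AP; apply: filterS (open_nbhs_nbhs (conj oA Ax)). Qed.

Lemma open_near (V : topologicalType) (x : V) (P : V -> Prop) :
  (\forall y \near x, P y) ->
  exists2 A, open A /\ A x & forall y, A y -> P y.
Proof. by rewrite /prop_near1 nbhsE => -[A]; exists A. Qed.

Lemma near_continuous (T U : topologicalType) (f : T -> U) x (B : set U) :
  {for x, continuous f} -> open B -> B (f x) -> \forall y \near x, B (f y).
Proof. by move=> cf oB Bfx; apply: (cf B); exact: open_nbhs_nbhs. Qed.

Lemma near_forall (T : topologicalType) (I : finType) (P : I -> T -> Prop)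
    (x : T) :
  (forall i, \forall y \near x, P i y) -> \forall y \near x, forall i, P i y.
Proof. by move=> /filter_forall. Qed.

Lemma continuous_sumr (R : realType) (T : topologicalType) (I : Type) (r : seq I)
    (F : I -> T -> R) z : (forall i, {for z, continuous (F i)}) ->
  {for z, continuous (fun y => \sum_(i <- r) F i y)}.
Proof.
move=> cF; elim: r => [|i r IH].
  rewrite (_ : (fun _ => _) = cst 0); first exact: cst_continuous.
  by apply/funext => y; rewrite big_nil.
rewrite (_ : (fun _ => _) = (fun y => F i y + \sum_(j <- r) F j y)).
  exact: continuousD (cF i) IH.
by apply/funext => y; rewrite big_cons.
Qed.

(** * Differentiability and class C^k *)

Section Differentiability.
Context {R : realType}.
Implicit Types V W : normedModType R.

Lemma differentiable_bound V W (f : V -> W) x (L : {linear V -> W}) :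
  continuous L ->
  (forall e, 0 < e ->
    \forall h \near 0, `|f (h + x) - f x - L h| <= e * `|h|) ->
  differentiable f x /\ ('d f x : V -> W) = L.
Proof.
move=> cL fL.
have fxL : f \o shift x = cst (f x) + L +o_ 0 id.
  apply/eqaddoP => e e0; move: (fL e e0); apply: filterS => h /=.
  by rewrite opprD addrA.
have dfL : ('d f x : V -> W) = L by apply: diff_unique.
by split=> //; apply/diff_locallyP; rewrite dfL.
Qed.

Lemma diff_bound V W (f : V -> W) x : differentiable f x ->
  forall e, 0 < e ->
    \forall h \near 0, `|f (h + x) - f x - 'd f x h| <= e * `|h|.
Proof.
move=> /diff_locallyP[_ /eqaddoP fx] e e0.
by move: (fx e e0); apply: filterS => h /=; rewrite opprD addrA.
Qed.

Lemma near_shift0 V (x : V) (P : set V) :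
  (\forall y \near x, P y) -> \forall h \near 0, P (h + x).
Proof. by rewrite (near_shift 0 x) subr0. Qed.

Lemma near_eq_differentiable V W (f g : V -> W) x :
  (\forall y \near x, f y = g y) -> differentiable f x -> differentiable g x.
Proof.
move=> fg df; have fgx := nbhs_singleton fg.
have [] // := @differentiable_bound _ _ g x ('d f x).
  exact: diff_continuous.
move=> e e0; move/near_shift0 : fg; have := diff_bound df e0.
by apply: filterS2 => h + <-; rewrite fgx.
Qed.

End Differentiability.

Section ClassC.
Context {R : realType}.
Implicit Types (V W : normedModType R) (k : nat).

Lemma class_C_sub V W k (A B : set V) (f : V -> W) :
  B `<=` A -> class_C k A f -> class_C k B f.
Proof.
move=> BA; elim: k f => [|k IH] f /=; first by move=> fA x /BA /fA.
by case=> df Df; split=> [x /BA /df//|v]; apply: IH.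
Qed.

(** Every clause of [class_C] is a condition at single points on a totally defined function and its
    total derivatives, so the pieces [B] can be arbitrary sets. *)
Lemma class_C_cover V W k (A : set V) (f : V -> W) :
  (forall x, A x -> exists2 B, B x & class_C k B f) -> class_C k A f.
Proof.
elim: k f => [|k IH] f /= fA; first by move=> x /fA[B Bx]; exact.
split=> [x /fA[B Bx []]|v]; first by move=> /(_ x Bx).
by apply: IH => x /fA[B Bx [_ /(_ v)]]; exists B.
Qed.

Lemma class_C_pred V W k (A : set V) (f : V -> W) :
  class_C k.+1 A f -> class_C k A f.
Proof.
elim: k f => [f [df _] x /df|k IH f [df Df]].
  exact: differentiable_continuous.
by split=> // v; apply/IH/Df.
Qed.

Lemma class_C_ext V W k (A : set V) (f g : V -> W) :
  open A -> (forall x, A x -> f x = g x) -> class_C k A f -> class_C k A g.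
Proof.
move=> oA; elim: k f g => [|k IH] f g fg /=.
  move=> fA x Ax; have fgx := near_open oA Ax fg.
  rewrite /prop_for /continuous_at -fg//; apply: cvg_trans (fA x Ax).
  by apply: near_eq_cvg; apply: filterS fgx => y ->.
case=> df Df; split=> [x Ax|v].
  exact: near_eq_differentiable (near_open oA Ax fg) (df x Ax).
apply: (IH _ _ _ (Df v)) => x Ax.
exact: near_eq_derive (near_open oA Ax fg).
Qed.

(** The induction step of the closure rules below: the definition speaks of the total function
    ['D_v f], whereas a formula for the derivative is available on [A] only. *)
Lemma class_CS V W k (A : set V) (f : V -> W) (df : V -> V -> W) : open A ->
  (forall x, A x -> differentiable f x) ->
  (forall v x, A x -> 'D_v f x = df v x) ->
  (forall v, class_C k A (df v)) -> class_C k.+1 A f.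
Proof.
move=> oA dfA Df Cdf; split=> // v.
by apply: class_C_ext (Cdf v) => // x Ax; rewrite Df.
Qed.

Lemma class_C_cst V W k (A : set V) (a : W) : class_C k A (cst a).
Proof.
elim: k a => [|k IH] a /=; first by move=> x _; exact: cst_continuous.
split=> [x _|v]; first exact: differentiable_cst.
rewrite (_ : 'D_v (cst a) = cst 0)//.
by apply/funext => x; rewrite derive_cst.
Qed.

Lemma class_C_lin V W k (A : set V) (L : {linear V -> W}) :
  continuous L -> class_C k A L.
Proof.
move=> cL; case: k => [|k] /=; first by move=> x _; exact: cL.
split=> [x _|v]; first exact: linear_differentiable.
rewrite (_ : 'D_v _ = cst (L v)); first exact: class_C_cst.
apply/funext => x; rewrite deriveE; last exact: linear_differentiable.
by rewrite diff_lin.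
Qed.

Lemma class_CD V W k (A : set V) (f g : V -> W) : open A ->
  class_C k A f -> class_C k A g -> class_C k A (fun x => f x + g x).
Proof.
move=> oA; elim: k f g => [|k IH] f g /=.
  by move=> fA gA x Ax; apply: cvgD; [exact: fA|exact: gA].
move=> [df Df] [dg Dg].
apply: (@class_CS _ _ _ _ _ (fun v x => 'D_v f x + 'D_v g x)) => //.
- by move=> x Ax; apply: differentiableD; [exact: df|exact: dg].
- move=> v x Ax; rewrite -[fun x => _]/(f + g) deriveD//.
    by apply: diff_derivable; exact: df.
  by apply: diff_derivable; exact: dg.
- by move=> v; apply: IH.
Qed.

Lemma class_C_sum V W k (A : set V) (I : Type) (r : seq I) (P : pred I)
    (F : I -> V -> W) : open A ->
  (forall i, class_C k A (F i)) ->
  class_C k A (fun x => \sum_(i <- r | P i) F i x).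
Proof.
move=> oA CF; elim: r => [|i r IH].
  rewrite (_ : (fun _ => _) = cst 0); first exact: class_C_cst.
  by apply/funext => x; rewrite big_nil.
under eq_fun do rewrite big_cons.
by case: (P i) => //; apply: class_CD.
Qed.

Lemma class_CM V k (A : set V) (f g : V -> R) : open A ->
  class_C k A f -> class_C k A g -> class_C k A (fun x => f x * g x).
Proof.
move=> oA; elim: k f g => [|k IH] f g.
  by move=> fA gA x Ax; apply: (continuousM (fA x Ax) (gA x Ax)).
move=> Cf Cg; have [df Df] := Cf; have [dg Dg] := Cg.
apply: (@class_CS _ _ _ _ _ (fun v x => f x * 'D_v g x + g x * 'D_v f x)) => //.
- by move=> x Ax; exact: (differentiableM (df x Ax) (dg x Ax)).
- move=> v x Ax; rewrite -[fun x => _]/(f * g) deriveM//.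
    by apply: diff_derivable; exact: df.
  by apply: diff_derivable; exact: dg.
- by move=> v; apply: class_CD => //; apply: IH; do ?[exact: Df|exact: Dg];
    exact: class_C_pred.
Qed.

(** The derivative of the inverse contains the inverse again, one order lower, so the induction runs
    on [k] with [f] fixed. *)
Lemma class_CV V k (A : set V) (f : V -> R) : open A ->
  (forall x, A x -> f x != 0) ->
  class_C k A f -> class_C k A (fun x => (f x)^-1).
Proof.
move=> oA f0; elim: k => [|k IH].
  by move=> fA x Ax; apply: (continuousV (f0 x Ax) (fA x Ax)).
move=> Cf; have [df Df] := Cf.
apply: (@class_CS _ _ _ _ _
  (fun v x => (-1) * ((f x)^-1 * (f x)^-1) * 'D_v f x)) => //.
- by move=> x Ax; apply: differentiableV; [exact: df|exact: f0].
- move=> v x Ax; rewrite deriveV//.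
  + by rewrite -exprVn expr2 mulN1r.
  + exact: f0.
  + by apply: diff_derivable; exact: df.
- move=> v; have CV := IH (class_C_pred Cf).
  apply: class_CM (Df v) => //; apply: class_CM => //.
    exact: (class_C_cst _ _ (-1 : R)).
  exact: class_CM.
Qed.

Lemma differentiable_rV V m (f : V -> 'rV[R]_m) x :
  (forall i, differentiable (fun y => f y ord0 i) x) -> differentiable f x.
Proof.
move=> df; have -> : f = \sum_(i < m) (fun y => f y ord0 i *: delta_mx ord0 i).
  apply/funext => y; rewrite fct_sumE [LHS]row_sum_delta.
  by apply: eq_bigr.
by apply: differentiable_sum => i; apply: differentiableZl.
Qed.

Lemma derive_rV V m (f : V -> 'rV[R]_m) x v i : differentiable f x ->
  ('D_v f x) ord0 i = 'D_v (fun y => f y ord0 i) x.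
Proof. by move=> df; rewrite derive_mx ?mxE//; exact: diff_derivable. Qed.

Lemma differentiable_coordf V m (f : V -> 'rV[R]_m) x i :
  differentiable f x -> differentiable (fun y => f y ord0 i) x.
Proof.
move=> df.
apply: (@differentiable_comp _ _ _ _ f (fun M : 'rV[R]_m => M ord0 i)) => //.
exact: differentiable_coord.
Qed.

Lemma class_C_rV V m k (A : set V) (f : V -> 'rV[R]_m) : open A ->
  class_C k A f <-> (forall i, class_C k A (fun x => f x ord0 i)).
Proof.
move=> oA; elim: k f => [|k IH] f.
  split=> [fA i x Ax|fA x Ax].
    apply: (@continuous_comp _ _ _ f (fun M : 'rV[R]_m => M ord0 i)).
      exact: fA.
    exact: coord_continuous.
  apply/cvgrPdist_le => e e0.
  near=> y.
  rewrite /Num.Def.normr/= mx_normrE (bigmax_le _ (ltW e0))//= => -[i j] _.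
  rewrite !mxE/= ord1; move: j; near: y; apply: filter_forall => j.
  by have /cvgrPdist_le := fA j x Ax; exact.
split=> [[df Df] i|fA].
  apply: (@class_CS _ _ _ _ _ (fun v x => 'D_v f x ord0 i)) => //.
  - by move=> x /df; exact: differentiable_coordf.
  - by move=> v x /df dfx; rewrite derive_rV.
  - move=> v; exact: ((IH _).1 (Df v) i).
split=> [x Ax|v].
  by apply: differentiable_rV => i; case: (fA i) => + _; exact.
apply/IH => i; case: (fA i) => _ /(_ v); apply: class_C_ext => // x Ax.
rewrite derive_rV//.
by apply: differentiable_rV => j; case: (fA j) => + _; exact.
Unshelve. all: by end_near. Qed.

Lemma diff_rV m W (f : 'rV[R]_m -> W) x v : differentiable f x ->
  'd f x v = \sum_i v ord0 i *: 'D_(delta_mx ord0 i) f x.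
Proof.
move=> df; rewrite {1}[v]row_sum_delta linear_sum.
by apply: eq_bigr => i _; rewrite linearZ deriveE.
Qed.

(** In coordinates the chain rule is a finite sum of products of scalar functions. The induction
    hypothesis, with a partial derivative in place of [g], covers one factor and [class_CM] the
    products. *)
Lemma class_C_comp1 V m k (A : set V) (B : set 'rV[R]_m) (f : V -> 'rV[R]_m)
    (g : 'rV[R]_m -> R) : open A -> (forall x, A x -> B (f x)) ->
  class_C k A f -> class_C k B g -> class_C k A (fun x => g (f x)).
Proof.
move=> oA AB; elim: k g => [|k IH] g.
  move=> fA gB x Ax; apply: (@continuous_comp _ _ _ f g); first exact: fA.
  exact/gB/AB.
move=> Cf [dg Dg]; have [df Df] := Cf.
apply: (@class_CS _ _ _ _ _
  (fun v x => \sum_i 'D_v f x ord0 i * 'D_(delta_mx ord0 i) g (f x))) => //.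
- move=> x Ax; apply: (@differentiable_comp _ _ _ _ f g); first exact: df.
  exact/dg/AB.
- move=> v x Ax; rewrite -[fun x => _]/(g \o f).
  have dfx := df x Ax; have dgx := dg _ (AB x Ax).
  rewrite deriveE; last exact: differentiable_comp.
  by rewrite diff_comp//= diff_rV// -deriveE.
- move=> v; apply: class_C_sum => // i; apply: class_CM => //.
    exact: ((class_C_rV _ _ oA).1 (Df v) i).
  by apply: (IH ('D_(delta_mx ord0 i) g)); [exact: class_C_pred|exact: Dg].
Qed.

Lemma class_C_comp V m p k (A : set V) (B : set 'rV[R]_m) (f : V -> 'rV[R]_m)
    (g : 'rV[R]_m -> 'rV[R]_p) : open A -> open B ->
  (forall x, A x -> B (f x)) ->
  class_C k A f -> class_C k B g -> class_C k A (g \o f).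
Proof.
move=> oA oB AB Cf /(class_C_rV _ _ oB) Cg; apply/class_C_rV => // i.
exact: class_C_comp1 AB Cf (Cg i).
Qed.

End ClassC.

(** * Germs of smooth functions *)

Section SmoothAt.
Context {R : realType}.
Implicit Types (V W : normedModType R).

(** [smooth_on] tests a total function at the points of a set only, so the version for germs has to
    carry an open neighborhood, the same one for all orders. *)
Definition smooth_at V W (f : V -> W) (x : V) : Prop :=
  exists2 A, open A /\ A x & smooth_on A f.

Lemma smooth_at_on V W (A : set V) (f : V -> W) :
  (forall x, A x -> smooth_at f x) -> smooth_on A f.
Proof.
by move=> fA k; apply: class_C_cover => x /fA[B [_ Bx] fB]; exists B.
Qed.

Lemma smooth_on_at V W (A : set V) (f : V -> W) x : open A -> A x ->
  smooth_on A f -> smooth_at f x.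
Proof. by move=> oA Ax fA; exists A. Qed.

Lemma smooth_at_near V W (f : V -> W) x : smooth_at f x ->
  \forall y \near x, smooth_at f y.
Proof. by case=> A [oA Ax] fA; apply: (near_open oA Ax) => y Ay; exists A. Qed.

Lemma smooth_at_ext V W (f g : V -> W) x : (\forall y \near x, f y = g y) ->
  smooth_at f x -> smooth_at g x.
Proof.
move=> /open_near[B [oB Bx] fg] [A [oA Ax] fA]; have oAB := openI oA oB.
exists (A `&` B) => // k; apply: (@class_C_ext _ _ _ _ _ f) => //.
  by move=> y [_ /fg].
by apply: class_C_sub (fA k); exact: subIsetl.
Qed.

Lemma smooth_at_differentiable V W (f : V -> W) x :
  smooth_at f x -> differentiable f x.
Proof. by case=> A [_ Ax] /(_ 1%N)[+ _]; exact. Qed.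

Lemma smooth_at_continuous V W (f : V -> W) x :
  smooth_at f x -> {for x, continuous f}.
Proof. by move/smooth_at_differentiable/differentiable_continuous. Qed.

Lemma smooth_at_derive V W (f : V -> W) x v :
  smooth_at f x -> smooth_at ('D_v f) x.
Proof. by case=> A Ax fA; exists A => // k; case: (fA k.+1) => _; exact. Qed.

Lemma smooth_at_cst V W (a : W) (x : V) : smooth_at (cst a) x.
Proof. by exists setT; [split=> //; exact: openT|move=> k; exact: class_C_cst]. Qed.

Lemma smooth_at_lin V W (L : {linear V -> W}) x :
  continuous L -> smooth_at L x.
Proof.
by move=> cL; exists setT; [split=> //; exact: openT|move=> k; exact: class_C_lin].
Qed.

Lemma smooth_at2 V W W' (f : V -> W) (g : V -> W') x :
  smooth_at f x -> smooth_at g x ->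
  exists2 A, open A /\ A x & smooth_on A f /\ smooth_on A g.
Proof.
move=> [A [oA Ax] fA] [B [oB Bx] gB].
exists (A `&` B); first by split => //; exact: openI.
by split=> k; [apply: class_C_sub (fA k)|apply: class_C_sub (gB k)] => y [].
Qed.

Lemma smooth_atD V W (f g : V -> W) x : smooth_at f x -> smooth_at g x ->
  smooth_at (fun y => f y + g y) x.
Proof.
move=> fx gx; have [A Ax [fA gA]] := smooth_at2 fx gx.
by exists A => // k; apply: class_CD => //; case: Ax.
Qed.

Lemma smooth_atM V (f g : V -> R) x : smooth_at f x -> smooth_at g x ->
  smooth_at (fun y => f y * g y) x.
Proof.
move=> fx gx; have [A Ax [fA gA]] := smooth_at2 fx gx.
by exists A => // k; apply: class_CM => //; case: Ax.
Qed.

Lemma smooth_at_sum V W (I : Type) (r : seq I) (P : pred I) (F : I -> V -> W) x :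
  (forall i, smooth_at (F i) x) ->
  smooth_at (fun y => \sum_(i <- r | P i) F i y) x.
Proof.
move=> CF; elim: r => [|i r IH].
  by under eq_fun do rewrite big_nil; exact: smooth_at_cst.
by under eq_fun do rewrite big_cons; case: (P i) => //; exact: smooth_atD.
Qed.

Lemma smooth_at_prod V (I : Type) (r : seq I) (P : pred I) (F : I -> V -> R) x :
  (forall i, smooth_at (F i) x) ->
  smooth_at (fun y => \prod_(i <- r | P i) F i y) x.
Proof.
move=> CF; elim: r => [|i r IH].
  by under eq_fun do rewrite big_nil; exact: smooth_at_cst.
by under eq_fun do rewrite big_cons; case: (P i) => //; exact: smooth_atM.
Qed.

Lemma smooth_atV V (f : V -> R) x : f x != 0 -> smooth_at f x ->
  smooth_at (fun y => (f y)^-1) x.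
Proof.
move=> fx0 fx; have cf := smooth_at_continuous fx; case: fx => A [oA Ax] fA.
have : \forall y \near x, A y /\ f y != 0.
  apply: filterI; first exact: open_nbhs_nbhs.
  exact: (near_continuous cf (@open_neq _ 0)).
move=> /open_near[B [oB Bx] BA]; exists B => // k.
apply: class_CV => //; first by move=> y /BA[].
by apply: class_C_sub (fA k) => y /BA[].
Qed.

Lemma smooth_at_rV V m (f : V -> 'rV[R]_m) x :
  smooth_at f x <-> forall i, smooth_at (fun y => f y ord0 i) x.
Proof.
split=> [[A [oA Ax] fA] i|fx].
  by exists A => // k; exact: ((class_C_rV _ _ oA).1 (fA k) i).
have /choice[A AP] : forall i, exists A : set V,
    [/\ open A, A x & smooth_on A (fun y => f y ord0 i)].
  by move=> i; have [A [? ?] ?] := fx i; exists A.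
have : \forall y \near x, forall i, A i y.
  by apply: filter_forall => i; case: (AP i) => oA Ax _; exact: open_nbhs_nbhs.
move=> /open_near[B [oB Bx] BA]; exists B => // k.
apply/class_C_rV => // i; case: (AP i) => _ _ /(_ k).
by apply: class_C_sub => y /BA.
Qed.

Lemma smooth_at_comp1 V m (f : V -> 'rV[R]_m) (g : 'rV[R]_m -> R) x :
  smooth_at f x -> smooth_at g (f x) -> smooth_at (fun y => g (f y)) x.
Proof.
move=> fx [B [oB Bfx] gB]; have cf := smooth_at_continuous fx.
case: fx => A [oA Ax] fA.
have : \forall y \near x, A y /\ B (f y).
  apply: filterI; first exact: open_nbhs_nbhs.
  exact: near_continuous cf oB Bfx.
move=> /open_near[C [oC Cx] CA]; exists C => // k.
apply: class_C_comp1 (gB k) => //; first by move=> y /CA[].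
by apply: class_C_sub (fA k) => y /CA[].
Qed.

Lemma smooth_at_comp V m p (f : V -> 'rV[R]_m) (g : 'rV[R]_m -> 'rV[R]_p) x :
  smooth_at f x -> smooth_at g (f x) -> smooth_at (g \o f) x.
Proof.
move=> fx /smooth_at_rV gx; apply/smooth_at_rV => i.
exact: smooth_at_comp1 fx (gx i).
Qed.

Lemma smooth_at_mulmx V m p (f : V -> 'rV[R]_m) (A : 'M[R]_(m, p)) x :
  smooth_at f x -> smooth_at (fun y => f y *m A) x.
Proof.
move=> /smooth_at_rV fx; apply/smooth_at_rV => i.
under eq_fun do rewrite mxE.
apply: smooth_at_sum => j; apply: smooth_atM; first exact: fx.
exact: (smooth_at_cst (A j i)).
Qed.

Lemma smooth_at_id m (x : 'rV[R]_m) : smooth_at id x.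
Proof. by apply: (@smooth_at_lin _ _ idfun) => y. Qed.

End SmoothAt.

(** * Strict differentiability *)

Section Norm.
Context {R : realType}.

Lemma norm_rV_le m (x : 'rV[R]_m) (e : R) : 0 <= e ->
  (forall j, `|x ord0 j| <= e) -> `|x| <= e.
Proof.
move=> e0 xe; rewrite /Num.Def.normr/= mx_normrE (bigmax_le _ e0)//= => -[i j] _.
by rewrite ord1.
Qed.

Lemma coord_le_norm m (x : 'rV[R]_m) j : `|x ord0 j| <= `|x|.
Proof.
rewrite [leRHS]/Num.Def.normr/= mx_normrE.
exact: (le_bigmax _ (fun ij => `|x ij.1 ij.2|) (ord0, j)).
Qed.

Lemma ball_convex (V : normedModType R) (b y z : V) r t :
  0 <= t <= 1 -> `|y - b| < r -> `|z - b| < r -> `|t *: y + (1 - t) *: z - b| < r.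
Proof.
move=> /andP[t0 t1] yr zr.
have -> : t *: y + (1 - t) *: z - b = t *: (y - b) + (1 - t) *: (z - b).
  rewrite !scalerBr addrACA -opprD -scalerDl.
  by rewrite (addrC t) subrK scale1r.
apply: le_lt_trans (ler_normD _ _) _; rewrite !normrZ.
rewrite (ger0_norm t0) ger0_norm ?subr_ge0//.
have [->|tn0] := eqVneq t 0; first by rewrite mul0r add0r subr0 mul1r.
have t_gt0 : 0 < t by rewrite lt_neqAle eq_sym tn0.
have : t * `|y - b| < t * r by rewrite ltr_pM2l.
have : (1 - t) * `|z - b| <= (1 - t) * r.
  by rewrite ler_wpM2l ?subr_ge0// ltW.
by move=> h1 h2; apply: lt_le_trans (ltr_leD h2 h1) _; rewrite -mulrDl addrC subrK mul1r.
Qed.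

Lemma diff_rV_coord m p (f : 'rV[R]_m -> 'rV[R]_p) x v j :
  differentiable f x ->
  'd f x v ord0 j = \sum_i v ord0 i * 'D_(delta_mx ord0 i) f x ord0 j.
Proof.
move=> df; have dfj := differentiable_coordf j df.
rewrite -deriveE// derive_rV// deriveE// diff_rV//.
by apply: eq_bigr => i _; rewrite derive_rV.
Qed.

(** The mean value theorem for each coordinate of [f] along the segment from [z] to [y] turns the
    continuity of the partial derivatives at [b] into an estimate that is uniform in both points. *)
Lemma strict_diff m p (f : 'rV[R]_m -> 'rV[R]_p) b : smooth_at f b ->
  forall e, 0 < e -> exists2 r, 0 < r & forall y z, `|y - b| < r -> `|z - b| < r ->
    `|f y - f z - 'd f b (y - z)| <= e * `|y - z|.
Proof.
(* The error sums over [m] partial derivatives; the successor keeps the divisor nonzero for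
   [m = 0]. *)
move=> fb e e0; pose e' := e / m.+1%:R.
have e'0 : 0 < e' by rewrite divr_gt0.
have Dnear : \forall w \near b, forall i,
    `|'D_(delta_mx ord0 i) f b - 'D_(delta_mx ord0 i) f w| <= e'.
  have : forall i, \forall w \near b,
    `|'D_(delta_mx ord0 i) f b - 'D_(delta_mx ord0 i) f w| <= e'; last first.
    by move=> /filter_forall.
  move=> i.
  have /smooth_at_continuous/cvgrPdist_le := smooth_at_derive (delta_mx ord0 i) fb.
  exact.
have dnear : \forall w \near b, differentiable f w.
  by apply: filterS (smooth_at_near fb) => w /smooth_at_differentiable.
have : nbhs b (fun w => differentiable f w /\ forall i,
    `|'D_(delta_mx ord0 i) f b - 'D_(delta_mx ord0 i) f w| <= e').
  exact: filterI dnear Dnear.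
move=> /nbhs_ballP[r /= r0]; rewrite -ball_normE /= => br.
exists r => // y z yr zr.
apply: norm_rV_le => [|j]; first by rewrite mulr_ge0// ltW.
pose w (t : R) : 'rV[R]_m := t *: y + (1 - t) *: z.
have wr (t : R) : 0 <= t <= 1 -> `|w t - b| < r by move=> ?; exact: ball_convex.
have dw (t : R) : is_derive t (1 : R) w (y - z).
  rewrite /w.
  have -> : (fun t => t *: y + (1 - t) *: z) = (fun t : R => z + t *: (y - z)).
    by apply/funext => s; rewrite scalerBl scalerBr scale1r addrCA.
  have dwt : is_diff t (fun t : R => z + t *: (y - z)) (0 + *:%R^~ (y - z)).
    exact: (@is_diffD _ _ _ (cst z) (fun s : R => s *: (y - z))).
  split; first by apply: diff_derivable; exact: ex_diff.
  by rewrite deriveE; [rewrite diff_val /= add0r scale1r|exact: ex_diff].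
pose g (t : R) : R := f (w t) ord0 j.
have dg (t : R) : 0 <= t <= 1 -> is_derive t (1 : R) g ('d f (w t) (y - z) ord0 j).
  move=> /wr; rewrite distrC => /br[dfw _].
  have dwt : differentiable w t by apply/derivable1_diffP; case: (dw t).
  have dfwt : differentiable (f \o w) t by exact: differentiable_comp.
  split; first by apply: diff_derivable; exact: (differentiable_coordf j dfwt).
  rewrite -(derive_rV (1 : R) j dfwt) deriveE// diff_comp//=; congr ('d f _ _ _ _).
  by rewrite -deriveE//; case: (dw t).
have [c cab] : exists2 c, c \in `[0, 1]%R &
    g 1 - g 0 = 'd f (w c) (y - z) ord0 j * (1 - 0).
  apply: MVT_segment => //.
    move=> t; rewrite in_itv /= => /andP[t0 t1].
    by apply: dg; rewrite !ltW.
  apply: derivable_within_continuous => t; rewrite in_itv/= => t01.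
  by case: (dg t t01).
have w1 : w 1 = y by rewrite /w scale1r subrr scale0r addr0.
have w0 : w 0 = z by rewrite /w scale0r subr0 scale1r add0r.
rewrite subr0 mulr1 /g w1 w0 => gE.
move: cab; rewrite in_itv/= => /wr; rewrite distrC => /br[dfw Dw].
have {}gE := etrans gE (diff_rV_coord (y - z) j dfw).
rewrite !mxE gE diff_rV_coord; last exact: smooth_at_differentiable.
rewrite -sumrB.
apply: le_trans (ler_norm_sum _ _ _) _.
apply: le_trans (_ : \sum_(i < m) e' * `|y - z| <= _); last first.
  rewrite sumr_const card_ord -mulr_natl mulrA ler_wpM2r// /e' mulrCA.
  by rewrite ger_pMr// ler_pdivrMr// mul1r ler_nat.
apply: ler_sum => i _; rewrite -mulrBr normrM mulrC.
apply: ler_pM => //; last exact: coord_le_norm.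
apply: le_trans (Dw i); rewrite distrC.
by have := coord_le_norm ('D_(delta_mx 0 i) f b - 'D_(delta_mx 0 i) f (w c)) j;
  rewrite !mxE.
Qed.

End Norm.

(** * The inverse function theorem *)

(** Completeness of the space of row vectors is what the fixed point argument in
    [open_image_perturbation] rests on. *)
HB.instance Definition _ (R : realType) (m n : nat) := Complete.on 'M[R]_(m, n).

Section InverseFunction.
Context {R : realType}.
Implicit Type V : normedModType R.

Lemma smooth_at_det V m (M : V -> 'M[R]_m) x :
  (forall i j, smooth_at (fun y => M y i j) x) ->
  smooth_at (fun y => \det (M y)) x.
Proof.
move=> Mx; apply: smooth_at_sum => s; apply: smooth_atM.
  exact: (smooth_at_cst ((-1) ^+ s : R)).
by apply: smooth_at_prod => i.
Qed.

(** Cramer's formula. It is valid only near [x], where the determinant stays nonzero, since [invmx]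
    returns a singular matrix unchanged. *)
Lemma smooth_at_invmx V m (M : V -> 'M[R]_m) x :
  (forall i j, smooth_at (fun y => M y i j) x) ->
  M x \in unitmx -> forall i j, smooth_at (fun y => invmx (M y) i j) x.
Proof.
move=> sM Mx i j; have sdet := smooth_at_det sM.
have det0 : \det (M x) != 0 by rewrite -unitfE -unitmxE.
apply: (@smooth_at_ext _ _ _
    (fun y => (\det (M y))^-1 * ((-1) ^+ (j + i) *
      \det (row' j (col' i (M y)))))).
  have := near_continuous (smooth_at_continuous sdet) (@open_neq _ 0) det0.
  by apply: filterS => y /= dy; rewrite /invmx unitmxE unitfE dy !mxE.
apply: smooth_atM; first exact: smooth_atV.
apply: smooth_atM; first exact: (smooth_at_cst ((-1) ^+ (j + i) : R)).
apply: smooth_at_det => k l; under eq_fun do rewrite !mxE.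
exact: sM.
Qed.

Lemma mulmxr_continuous m p (A : 'M[R]_(m, p)) :
  continuous (mulmxr A : 'rV[R]_m -> 'rV[R]_p).
Proof.
move=> x; apply: (@smooth_at_continuous _ _ _ (fun y : 'rV[R]_m => y *m A)).
exact/smooth_at_mulmx/smooth_at_id.
Qed.

Lemma mulmx_bound m p (A : 'M[R]_(m, p)) :
  exists2 k, 0 < k & forall v : 'rV[R]_m, `|v *m A| <= k * `|v|.
Proof. exact: linear_lipschitz (@mulmxr_continuous m p A). Qed.

Lemma diff_mulmx V m p (f : V -> 'rV[R]_m) (A : 'M[R]_(m, p)) x v :
  differentiable f x -> 'd (fun y => f y *m A) x v = 'd f x v *m A.
Proof.
move=> df; rewrite -[fun y => _]/(mulmxr A \o f).
have cA := @mulmxr_continuous _ _ A.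
rewrite diff_comp//=; last exact: linear_differentiable.
by rewrite diff_lin.
Qed.

Lemma jacobian_unit m (f : 'rV[R]_m -> 'rV[R]_m) x :
  injective ('d f x) <-> 'J f x \in unitmx.
Proof.
rewrite -row_free_unit; split=> [inj|/row_freeP[B JB] v w].
  rewrite -kermx_eq0; apply/eqP/row_matrixP => i; rewrite row0; apply: inj.
  by rewrite linear0 -mul_rV_lin1 -row_mul mulmx_ker row0.
rewrite -!(mul_rV_lin1 ('d f x)) => /(congr1 (mulmx^~ B)).
by rewrite -!mulmxA JB !mulmx1.
Qed.

(** Solving [F z = w] means finding a fixed point of [z - F z + w]. The hypothesis makes this map a
    contraction with factor one half, so Banach's theorem applies on a small closed ball. *)
Lemma open_image_perturbation m (F : 'rV[R]_m -> 'rV[R]_m) a r :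
  (forall y z, `|y - a| < r -> `|z - a| < r ->
    `|F y - F z - (y - z)| <= 2^-1 * `|y - z|) ->
  open (F @` [set y | `|y - a| < r]).
Proof.
move=> FL; rewrite openE => _ [x /= xr <-].
(* Half the distance from [x] to the boundary sphere, so that the closed ball [U] of radius [s]
   stays inside. Targets [w] within [s / 2] of [F x] then keep [U] stable: [s / 2] comes from the
   contraction and [s / 2] from [w]. *)
pose s := (r - `|x - a|) / 2.
have s0 : 0 < s by rewrite divr_gt0// subr_gt0.
have sB z : `|z - x| <= s -> `|z - a| < r.
  move=> zs; have := ler_normD (z - x) (x - a).
  rewrite addrA subrK; move: zs xr; rewrite /s; lra.
apply/nbhs_ballP; exists (s / 2); first by rewrite /= divr_gt0.
move=> w; rewrite -ball_normE /= => ws.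
pose U := [set z : 'rV[R]_m | `|z - x| <= s].
pose G z := (z - F z) + w.
have GU : forall z, U z -> U (G z).
  move=> z Uz; rewrite /U /= /G.
  have -> : z - F z + w - x = - (F z - F x - (z - x)) - (F x - w).
    apply/rowP => i; rewrite !mxE; ring.
  apply: le_trans (ler_normB _ _) _; rewrite normrN.
  have := FL z x (sB z Uz) xr; move: Uz; rewrite /U /=.
  move: ws; lra.
have [Gf Gfe] : exists Gf : {fun U >-> U}, Gf = G :> ('rV[R]_m -> 'rV[R]_m).
  pose Gm := isFun.Build _ _ U U G GU.
  by exists (HB.pack_for {fun U >-> U} G Gm).
have ctr : is_contraction Gf.
  exists (2^-1)%:nng; split => /=; first by rewrite invf_lt1// ltr1n.
  move=> [y z] [Uy Uz] /=; rewrite Gfe /G.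
  have -> : y - F y + w - (z - F z + w) = - (F y - F z - (y - z)).
    apply/rowP => i; rewrite !mxE; ring.
  by rewrite normrN; apply: FL; exact: sB.
have cU : closed U.
  rewrite (_ : U = closed_ball_ Num.norm x s); last first.
    by apply/seteqP; split => z; rewrite /U /closed_ball_ /= distrC.
  exact: closed_closed_ball_.
have [|z Uz] := banach_fixed_point ctr cU.
  by exists x; rewrite /U /= subrr normr0 ltW.
rewrite Gfe /G => zE; exists z; first exact: sB.
have /eqP := zE; rewrite -subr_eq0 => /eqP/rowP zE'.
apply/rowP => i; have := zE' i; rewrite !mxE; lra.
Qed.

(** Multiplied by the inverse Jacobian at [a], [f] becomes a map [F] whose difference from the
    identity is Lipschitz with constant one half near [a]. Hence [F] is injective with a Lipschitz
    inverse, and its image is open; both properties pass back to [f]. *)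
Theorem inverse_function m (f : 'rV[R]_m -> 'rV[R]_m) a (A : set 'rV[R]_m) :
  nbhs a A -> smooth_at f a -> injective ('d f a) ->
  exists B g, [/\ open B /\ B a, B `<=` A, open (f @` B),
    forall x, B x -> g (f x) = x &
    forall x, B x -> smooth_at f x /\ smooth_at g (f x)].
Proof.
move=> aA fa /jacobian_unit Ja.
have sJ x : smooth_at f x -> forall i j, smooth_at (fun y => 'J f y i j) x.
  move=> fx i j; move/(smooth_at_derive (delta_mx 0 i))/smooth_at_rV : (fx).
  move=> /(_ j); apply: smooth_at_ext; apply: filterS (smooth_at_near fx) => y fy.
  by rewrite deriveE ?mxE//; exact: smooth_at_differentiable.
have Junit : \forall x \near a, 'J f x \in unitmx.
  have Ja0 : \det ('J f a) != 0 by rewrite -unitfE -unitmxE.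
  have := near_continuous (smooth_at_continuous (smooth_at_det (sJ a fa)))
    (@open_neq _ 0) Ja0.
  by apply: filterS => x; rewrite unitmxE unitfE.
pose F x := f x *m invmx ('J f a).
have Fa : smooth_at F a by exact: smooth_at_mulmx.
have dfa := smooth_at_differentiable fa.
have [|r0 r00 FL] := @strict_diff _ _ _ F a Fa 2^-1; first by rewrite invr_gt0.
have : nbhs a (A `&` (fun x => smooth_at f x) `&` (fun x => 'J f x \in unitmx)).
  exact: filterI (filterI aA (smooth_at_near fa)) Junit.
move=> /nbhs_ballP[r1 /= r10]; rewrite -ball_normE => r1P.
pose r := Num.min r0 r1.
have r_gt0 : 0 < r by rewrite lt_min r00.
pose B := [set y : 'rV[R]_m | `|y - a| < r].
have oB : open B.
  rewrite (_ : B = ball a r); first exact: ball_open.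
  by apply/seteqP; split => y; rewrite -ball_normE /B /= distrC.
have BP y : B y -> [/\ A y, smooth_at f y & 'J f y \in unitmx].
  by rewrite /B /= lt_min distrC => /andP[_ /r1P[[]]].
have Ba : B a by rewrite /B /= subrr normr0.
have {}FL y z : B y -> B z -> `|F y - F z - (y - z)| <= 2^-1 * `|y - z|.
  rewrite /B /= !lt_min => /andP[yr _] /andP[zr _].
  have := FL y z yr zr; rewrite /F diff_mulmx// -(mul_rV_lin1 ('d f a)).
  by rewrite -/(jacobian f a) mulmxK.
have Flow y z : B y -> B z -> `|y - z| <= 2 * `|F y - F z|.
  move=> By Bz; have := FL y z By Bz.
  have := ler_normB (F y - F z) (F y - F z - (y - z)).
  by rewrite opprB addrCA subrr addr0; lra.
have [K K0 KP] := mulmx_bound (invmx ('J f a)).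
have flow y z : B y -> B z -> `|y - z| <= 2 * K * `|f y - f z|.
  move=> By Bz; apply: le_trans (Flow y z By Bz) _.
  by rewrite -mulrA ler_wpM2l// /F -mulmxBl.
have finj y z : B y -> B z -> f y = f z -> y = z.
  move=> By Bz fyz; apply/eqP; rewrite -subr_eq0 -normr_le0.
  by apply: le_trans (flow y z By Bz) _; rewrite fyz subrr normr0 mulr0.
have ofB : open (f @` B).
  rewrite (_ : f @` B = (mulmxr (invmx ('J f a)) : 'rV[R]_m -> 'rV[R]_m) @^-1` (F @` B)).
    apply: open_comp; first by move=> x _; exact: mulmxr_continuous.
    exact: open_image_perturbation.
  apply/seteqP; split=> [_ [x Bx <-]|y [x Bx]] /=; first by exists x.
  move=> Fx; exists x => //; move: Fx; rewrite /F => /(congr1 (mulmx^~ ('J f a))).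
  by rewrite !mulmxKV.
pose g y := xget 0 [set x | B x /\ f x = y].
have gP y : (f @` B) y -> B (g y) /\ f (g y) = y.
  move=> [x Bx fx]; rewrite /g.
  by case: xgetP => [z _ [] //|/(_ x)[]].
have gf x : B x -> g (f x) = x.
  move=> Bx; have [|Bg fg] := gP (f x); first by exists x.
  exact: finj.
have glip y : (f @` B) y -> forall z, (f @` B) z -> `|g y - g z| <= 2 * K * `|y - z|.
  move=> /gP[Bgy fgy] z /gP[Bgz fgz].
  by rewrite -{2}fgy -{2}fgz; exact: flow.
have gdiff y : (f @` B) y -> differentiable g y /\
    ('d g y : 'rV[R]_m -> 'rV[R]_m) = mulmxr (invmx ('J f (g y))).
  move=> fBy; have [Bgy fgy] := gP y fBy; have [_ sfg Jg] := BP _ Bgy.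
  apply: differentiable_bound; first exact: mulmxr_continuous.
  move=> e e0; have [K' K'0 K'P] := mulmx_bound (invmx ('J f (g y))).
  (* The increment [k] of [g] has norm at most [2 * K * |h|], and [K'] bounds the inverse Jacobian
     at [g y]; with this [e'] the error of [f] at [g y] becomes [e * |h|]. *)
  pose e' := e / (K' * (2 * K)).
  have KK : 0 < K' * (2 * K) by rewrite !mulr_gt0.
  have e'0 : 0 < e' by rewrite divr_gt0.
  have dfg := smooth_at_differentiable sfg.
  have := diff_bound dfg e'0.
  move=> /nbhs_ballP[d /= d0]; rewrite -ball_normE /= => dP.
  have nY : \forall h \near (0 : 'rV[R]_m), (f @` B) (h + y).
    by apply: near_shift0; exact: open_nbhs_nbhs.
  have nd : \forall h \near (0 : 'rV[R]_m), `|h| < d / (2 * K).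
    apply/nbhs_ballP; exists (d / (2 * K)); first by rewrite /= divr_gt0// mulr_gt0.
    by move=> h; rewrite -ball_normE /= sub0r normrN.
  apply: filterS2 nY nd => h Yh hd.
  pose k := g (h + y) - g y.
  have kh : `|k| <= 2 * K * `|h|.
    by have := glip _ Yh _ fBy; rewrite addrK.
  have kd : `|k| < d.
    by apply: le_lt_trans kh _; rewrite mulrC -ltr_pdivlMr// mulr_gt0.
  have /dP : `|0 - k| < d by rewrite sub0r normrN.
  rewrite /k subrK (gP _ Yh).2 fgy addrK -/k => dk.
  have -> : k - h *m invmx ('J f (g y)) =
      - ((h - 'd f (g y) k) *m invmx ('J f (g y))).
    rewrite -(mul_rV_lin1 ('d f (g y))) -/(jacobian f (g y)).
    by rewrite mulmxBl mulmxK// opprB.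
  rewrite normrN; apply: le_trans (K'P _) _.
  apply: le_trans (_ : K' * (e' * (2 * K * `|h|)) <= _).
    rewrite ler_pM2l//; apply: le_trans dk _.
    by rewrite ler_pM2l.
  rewrite [K' * _]mulrCA mulrA mulrA -mulrA -/(K' * _) /e'.
  have -> : e / (K' * (2 * K)) * K' * (2 * K * `|h|) = e * `|h|.
    by field; rewrite !gt_eqF// ?mulr_gt0.
  by [].
(* Bootstrap: the derivative [v *m invmx ('J f (g y))] is a smooth function of [g y], so it is as
   regular as [g], and [g] gains one order. *)
have gsmooth : smooth_on (f @` B) g.
  elim=> [|k IH].
    by move=> y /gdiff[dg _]; exact: differentiable_continuous.
  apply: (@class_CS _ _ _ _ _ _ (fun v y => v *m invmx ('J f (g y)))) => //.
  - by move=> y /gdiff[].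
  - by move=> v y /gdiff[dg dgE]; rewrite deriveE// dgE.
  - move=> v; apply: (class_C_comp (B := B) (f := g)
      (g := fun x => v *m invmx ('J f x))) => //.
      by move=> y /gP[].
    apply: smooth_at_on => x /BP[_ sfx Jx]; apply/smooth_at_rV => i.
    under eq_fun do rewrite mxE.
    apply: smooth_at_sum => j; apply: smooth_atM.
      exact: (smooth_at_cst (v ord0 j)).
    by apply: smooth_at_invmx => // p q; exact: sJ.
exists B, g; split=> //; first by move=> x /BP[].
move=> x Bx; split; first by case: (BP x Bx).
by exists (f @` B); [split=> //; exists x|].
Qed.

End InverseFunction.

(** * Smooth maps in charts *)

Section Jacobian.
Context {R : realType} {m n : nat}.
Implicit Types f g : 'rV[R]_m -> 'rV[R]_n.

Lemma jacobianP f x (A : 'M[R]_(m, n)) : differentiable f x ->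
  (forall v, 'D_v f x = v *m A) -> 'J f x = A.
Proof.
move=> df fA; apply/row_matrixP => i.
by rewrite !rowE -deriveEjacobian.
Qed.

Lemma jacobianD f g x : differentiable f x -> differentiable g x ->
  'J (fun y => f y + g y) x = 'J f x + 'J g x.
Proof.
move=> df dg; apply: jacobianP => [|v]; first exact: differentiableD.
have -> : 'D_v (fun y => f y + g y) x = 'D_v f x + 'D_v g x.
  by rewrite -deriveD; [|exact: diff_derivable..].
by rewrite mulmxDr !deriveEjacobian.
Qed.

Lemma jacobian_mulmx p f (A : 'M[R]_(n, p)) x : smooth_at f x ->
  'J (fun y => f y *m A) x = 'J f x *m A.
Proof.
move=> sf; have df := smooth_at_differentiable sf.
apply/row_matrixP => i; rewrite !rowE mulmxA !mul_rV_lin1.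
exact: diff_mulmx.
Qed.

End Jacobian.

Lemma jacobian_id (R : realType) n (x : 'rV[R]_n) : 'J id x = 1%:M.
Proof.
apply: jacobianP => [|v]; last by rewrite mulmx1 derive_id.
exact/smooth_at_differentiable/smooth_at_id.
Qed.

Section LocalDiff.
Context {R : realType}.

Lemma near_eq_diff (V W : normedModType R) (f g : V -> W) x :
  (\forall y \near x, f y = g y) -> differentiable f x ->
  ('d f x : V -> W) = 'd g x.
Proof.
move=> fg df; have dg := near_eq_differentiable fg df.
apply/funext => v; rewrite -(deriveE v df) -(deriveE v dg).
exact: near_eq_derive.
Qed.

Lemma near_eq_diff_inj (V W : normedModType R) (f g : V -> W) x :
  (\forall y \near x, f y = g y) -> differentiable f x ->
  injective ('d f x) -> injective ('d g x).
Proof. by move=> fg df; rewrite (near_eq_diff fg df). Qed.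

Lemma diff_comp_inj m n p (f : 'rV[R]_m -> 'rV[R]_n) (g : 'rV[R]_n -> 'rV[R]_p)
    x y : f x = y -> differentiable f x -> differentiable g y ->
  injective ('d f x) -> injective ('d g y) -> injective ('d (g \o f) x).
Proof. by move=> <- df dg fi gi; rewrite diff_comp//; exact: inj_comp. Qed.

Lemma diff_comp_injl m n p (f : 'rV[R]_m -> 'rV[R]_n) (g : 'rV[R]_n -> 'rV[R]_p)
    x y : f x = y -> differentiable f x -> differentiable g y ->
  injective ('d (g \o f) x) -> injective ('d f x).
Proof. by move=> <- df dg; rewrite diff_comp// => /inj_compr. Qed.

Lemma diff_id_inj n (x : 'rV[R]_n) : injective ('d (id : 'rV[R]_n -> 'rV[R]_n) x).
Proof.
have -> : 'd (id : 'rV[R]_n -> 'rV[R]_n) x = id :> ('rV[R]_n -> 'rV[R]_n).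
  have := @diff_lin _ _ _ (idfun : {linear 'rV[R]_n -> 'rV[R]_n}) x.
  by apply=> y; exact: cvg_id.
by move=> u v.
Qed.

Lemma diff_left_inverse_inj m n (g : 'rV[R]_m -> 'rV[R]_n)
    (f : 'rV[R]_n -> 'rV[R]_m) x y :
  g x = y -> differentiable g x -> differentiable f y ->
  (\forall z \near x, f (g z) = z) -> injective ('d g x).
Proof.
move=> gx dg df fg; apply: (diff_comp_injl gx dg df).
apply: (@near_eq_diff_inj _ _ id _ _ _ _ (@diff_id_inj _ x)).
  by apply: filterS fg => z fgz; rewrite /= fgz.
exact/smooth_at_differentiable/smooth_at_id.
Qed.

End LocalDiff.

Section Charts.
Context {R : realType}.
Implicit Types M N P : topologicalType.

Lemma near_cinv n M (phi : coord_chart R n M) x (Q : set M) : cdom phi x ->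
  (\forall z \near x, Q z) -> \forall y \near cmap phi x, Q (cinv phi y).
Proof.
move=> xphi Qx; have cc := cinv_continuous (cmap_cod xphi).
by apply: (cc Q); rewrite cmapK.
Qed.

Lemma near_cmap n M (phi : coord_chart R n M) x (Q : set 'rV[R]_n) :
  cdom phi x ->
  (\forall y \near cmap phi x, Q y) -> \forall z \near x, Q (cmap phi z).
Proof. by move=> xphi Qx; exact: (cmap_continuous xphi Qx). Qed.

Lemma near_cdom n M (phi : coord_chart R n M) x :
  cdom phi x -> \forall z \near x, cdom phi z.
Proof. by move=> xphi; apply: (near_open (cdom_open phi) xphi). Qed.

Lemma near_ccod n M (phi : coord_chart R n M) x :
  cdom phi x -> \forall y \near cmap phi x, ccod phi y.
Proof.
move=> /cmap_cod xphi; apply: (near_open _ xphi) => //.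
exact: (@ccod_open _ _ _ phi).
Qed.

Lemma open_cinv n M (phi : coord_chart R n M) (U : set M) : open U ->
  open [set y | ccod phi y /\ U (cinv phi y)].
Proof.
move=> oU; rewrite openE => y [yc Uy].
have yE := cinvK yc; rewrite -yE; apply: filterI.
  exact/near_ccod/cinv_dom.
by apply: near_cinv; [exact: cinv_dom|exact: near_open oU Uy _].
Qed.

Lemma open_cmap n M (phi : coord_chart R n M) (U : set 'rV[R]_n) : open U ->
  open [set x | cdom phi x /\ U (cmap phi x)].
Proof.
move=> oU; rewrite openE => x [xd Ux].
apply: filterI; first exact: near_cdom.
by apply: near_cmap => //; exact: near_open oU Ux _.
Qed.

(** With [f := id] and two charts of one space this is the smoothness of a transition map, so that a
    change of charts is a case of composition. *)
Definition smooth_in m n M N (phi : coord_chart R m M) (psi : coord_chart R n N)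
    (f : M -> N) (x : M) : Prop :=
  smooth_at (cmap psi \o f \o cinv phi) (cmap phi x).

Definition immersive_in m n M N (phi : coord_chart R m M)
    (psi : coord_chart R n N) (f : M -> N) (x : M) : Prop :=
  smooth_in phi psi f x /\
  injective ('d (cmap psi \o f \o cinv phi) (cmap phi x)).

Section Compose.
Context {m n p : nat} {M N P : topologicalType}.
Context (phi : coord_chart R m M) (psi : coord_chart R n N)
  (chi : coord_chart R p P).
Context (f : M -> N) (g : N -> P) (x : M).
Hypotheses (cf : {for x, continuous f}) (xphi : cdom phi x)
  (fxpsi : cdom psi (f x)).

Let fE : (cmap psi \o f \o cinv phi) (cmap phi x) = cmap psi (f x).
Proof. by rewrite /= cmapK. Qed.

(** The coordinate expressions compose only locally: farther away [f] may leave [cdom psi], where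
    [cinv psi] no longer undoes [cmap psi]. *)
Let near_comp : \forall y \near cmap phi x,
  ((cmap chi \o g \o cinv psi) \o (cmap psi \o f \o cinv phi)) y =
  (cmap chi \o (g \o f) \o cinv phi) y.
Proof.
have : \forall y \near cmap phi x, cdom psi (f (cinv phi y)).
  apply: (near_cinv (Q := fun z => cdom psi (f z))) => //.
  exact: near_continuous cf (cdom_open psi) fxpsi.
by apply: filterS => y /= ydom; rewrite cmapK.
Qed.

Lemma smooth_in_comp : smooth_in phi psi f x -> smooth_in psi chi g (f x) ->
  smooth_in phi chi (g \o f) x.
Proof.
move=> sf sg; apply: smooth_at_ext near_comp _; apply: smooth_at_comp => //.
by rewrite fE.
Qed.

Lemma immersive_in_comp : immersive_in phi psi f x ->
  immersive_in psi chi g (f x) -> immersive_in phi chi (g \o f) x.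
Proof.
move=> [sf fi] [sg gi]; split; first exact: smooth_in_comp.
apply: near_eq_diff_inj near_comp _ _.
  by apply: smooth_at_differentiable; apply: smooth_at_comp => //; rewrite fE.
apply: diff_comp_inj fE _ _ fi gi; exact: smooth_at_differentiable.
Qed.

Lemma immersive_in_left : smooth_in phi psi f x -> smooth_in psi chi g (f x) ->
  immersive_in phi chi (g \o f) x -> immersive_in phi psi f x.
Proof.
move=> sf sg [sgf gfi]; split => //.
apply: (diff_comp_injl (g := cmap chi \o g \o cinv psi) fE).
- exact: smooth_at_differentiable.
- exact: smooth_at_differentiable.
- apply: near_eq_diff_inj gfi; last exact: smooth_at_differentiable.
  by apply: filterS near_comp.
Qed.

End Compose.

Lemma immersive_in_id n M (phi : coord_chart R n M) x :
  cdom phi x -> immersive_in phi phi id x.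
Proof.
move=> xphi.
have E : \forall y \near cmap phi x, id y = (cmap phi \o id \o cinv phi) y.
  by apply: filterS (near_ccod xphi) => y yc /=; rewrite cinvK.
split; first by apply: smooth_at_ext E _; exact: smooth_at_id.
apply: near_eq_diff_inj E _ _.
  exact/smooth_at_differentiable/smooth_at_id.
exact: diff_id_inj.
Qed.

End Charts.

Section Manifolds.
Context {R : realType}.

Section Transition.
Context {n : nat} {M : manifold R n}.
Implicit Types phi psi : coord_chart R n M.

Lemma smooth_transitionP phi psi : smooth_transition phi psi <->
  forall x, cdom phi x -> cdom psi x -> smooth_in phi psi id x.
Proof.
split=> [phipsi x xphi xpsi|sm].
  apply: smooth_on_at phipsi; first exact: open_cinv (cdom_open psi).
  by split; [exact: cmap_cod|rewrite /= cmapK].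
apply: smooth_at_on => y [yc yd].
have := sm (cinv phi y) (cinv_dom yc) yd.
by rewrite /smooth_in cinvK.
Qed.

Lemma matlas_smooth_chart phi : matlas phi -> smooth_chart phi.
Proof. by move=> aphi psi apsi; split; exact: matlas_smooth. Qed.

Lemma smooth_in_id phi psi x : smooth_chart phi -> smooth_chart psi ->
  cdom phi x -> cdom psi x -> smooth_in phi psi id x.
Proof.
move=> sphi spsi xphi xpsi; have [chi achi xchi] := matlas_cover x.
apply: (@smooth_in_comp _ _ _ _ _ _ _ phi chi psi id id) => //.
- by case: (sphi _ achi) => /smooth_transitionP/(_ x xphi xchi).
- by case: (spsi _ achi) => _ /smooth_transitionP/(_ x xchi xpsi).
Qed.

Lemma immersive_in_trans phi psi x : smooth_chart phi -> smooth_chart psi ->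
  cdom phi x -> cdom psi x -> immersive_in phi psi id x.
Proof.
move=> sphi spsi xphi xpsi.
apply: (@immersive_in_left _ _ _ _ _ _ _ phi psi phi id id) => //.
- exact: smooth_in_id.
- exact: smooth_in_id.
- exact: immersive_in_id.
Qed.

End Transition.

Context {m n : nat} {M : manifold R m} {N : manifold R n}.
Implicit Types (f : M -> N) (phi : coord_chart R m M) (psi : coord_chart R n N).

Lemma smooth_in_charts f phi psi phi' psi' x :
  smooth_chart phi -> smooth_chart psi -> smooth_chart phi' ->
  smooth_chart psi' -> cdom phi x -> cdom psi (f x) -> cdom phi' x ->
  cdom psi' (f x) -> {for x, continuous f} ->
  smooth_in phi psi f x -> smooth_in phi' psi' f x.
Proof.
move=> sphi spsi sphi' spsi' xphi fxpsi xphi' fxpsi' cf sf.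
apply: (@smooth_in_comp _ _ _ _ _ _ _ phi' phi psi' id f) => //.
  exact: smooth_in_id.
apply: (@smooth_in_comp _ _ _ _ _ _ _ phi psi psi' f id) => //.
exact: smooth_in_id.
Qed.

Lemma immersive_in_charts f phi psi phi' psi' x :
  smooth_chart phi -> smooth_chart psi -> smooth_chart phi' ->
  smooth_chart psi' -> cdom phi x -> cdom psi (f x) -> cdom phi' x ->
  cdom psi' (f x) -> {for x, continuous f} ->
  immersive_in phi psi f x -> immersive_in phi' psi' f x.
Proof.
move=> sphi spsi sphi' spsi' xphi fxpsi xphi' fxpsi' cf sf.
have tphi := immersive_in_trans sphi' sphi xphi' xphi.
have tpsi := immersive_in_trans spsi spsi' fxpsi fxpsi'.
have fid := immersive_in_comp cf xphi fxpsi sf tpsi.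
have cid : {for x, continuous (id : M -> M)} by [].
exact: (immersive_in_comp cid xphi' xphi tphi fid).
Qed.

Lemma smooth_map_in f phi psi x : smooth_map f ->
  smooth_chart phi -> smooth_chart psi -> cdom phi x -> cdom psi (f x) ->
  smooth_in phi psi f x.
Proof.
move=> [cf sf] sphi spsi xphi fxpsi.
have [phi' aphi' xphi'] := matlas_cover x.
have [psi' apsi' fxpsi'] := matlas_cover (f x).
apply: (@smooth_in_charts _ phi' psi') => //; do ?exact: matlas_smooth_chart.
  exact: cf.
apply: (smooth_on_at _ _ (sf _ _ aphi' apsi')).
  apply: (@open_cinv _ _ _ phi' (f @^-1` cdom psi')).
  by apply: open_comp; [move=> ? _; exact: cf|exact: cdom_open].
by split; [exact: cmap_cod|rewrite /= cmapK].
Qed.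

Lemma smooth_mapP f : continuous f ->
  (forall x, exists phi psi, [/\ smooth_chart phi, smooth_chart psi, cdom phi x,
     cdom psi (f x) & smooth_in phi psi f x]) -> smooth_map f.
Proof.
move=> cf sf; split=> // phi psi aphi apsi; apply: smooth_at_on => y [yc yd].
have [phi' [psi' [sphi' spsi' xphi' fxpsi' sfx]]] := sf (cinv phi y).
rewrite -(cinvK yc) -/(smooth_in phi psi f _).
apply: (@smooth_in_charts _ phi' psi') => //; do ?exact: matlas_smooth_chart.
  exact: cinv_dom.
exact: cf.
Qed.

Lemma immersion_in f phi psi x : immersion f ->
  smooth_chart phi -> smooth_chart psi -> cdom phi x -> cdom psi (f x) ->
  immersive_in phi psi f x.
Proof.
move=> [sf fi] sphi spsi xphi fxpsi.
have [phi' aphi' xphi'] := matlas_cover x.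
have [psi' apsi' fxpsi'] := matlas_cover (f x).
have sphi' := matlas_smooth_chart aphi'; have spsi' := matlas_smooth_chart apsi'.
have [cf _] := sf; have fx' := fi x phi' psi' aphi' apsi' xphi' fxpsi'.
exact: (immersive_in_charts sphi' spsi' sphi spsi xphi' fxpsi' xphi fxpsi (cf x)
  (conj (smooth_map_in sf sphi' spsi' xphi' fxpsi') fx')).
Qed.

Lemma immersionP f : continuous f ->
  (forall x, exists phi psi, [/\ smooth_chart phi, smooth_chart psi, cdom phi x,
     cdom psi (f x) & immersive_in phi psi f x]) -> immersion f.
Proof.
move=> cf fi; split.
  apply: smooth_mapP => // x; have [phi [psi [? ? ? ? []]]] := fi x.
  by exists phi, psi.
move=> x phi psi aphi apsi xphi fxpsi.
have [phi' [psi' [sphi' spsi' xphi' fxpsi' fx]]] := fi x.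
have sphi := matlas_smooth_chart aphi; have spsi := matlas_smooth_chart apsi.
by have [] := immersive_in_charts sphi' spsi' sphi spsi xphi' fxpsi' xphi fxpsi
  (@cf x) fx.
Qed.

End Manifolds.

Section Embeddings.
Context {R : realType} {m n p : nat}.
Context {M : manifold R m} {N : manifold R n} {P : manifold R p}.

Lemma smooth_map_comp (f : M -> N) (g : N -> P) :
  smooth_map f -> smooth_map g -> smooth_map (g \o f).
Proof.
move=> sf sg; have [cf _] := sf; have [cg _] := sg.
apply: smooth_mapP => [x|x]; first exact: (continuous_comp (cf x) (cg (f x))).
have [phi aphi xphi] := matlas_cover x.
have [psi apsi xpsi] := matlas_cover (f x).
have [chi achi xchi] := matlas_cover (g (f x)).
have sphi := matlas_smooth_chart aphi; have spsi := matlas_smooth_chart apsi.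
have schi := matlas_smooth_chart achi.
exists phi, chi; split; [by []..|].
exact: (smooth_in_comp (cf x) xphi xpsi
  (smooth_map_in sf sphi spsi xphi xpsi) (smooth_map_in sg spsi schi xpsi xchi)).
Qed.

Lemma smooth_embedding_comp (f : M -> N) (g : N -> P) :
  smooth_embedding f -> smooth_embedding g -> smooth_embedding (g \o f).
Proof.
move=> [fi finj fo] [gi ginj go].
have [[cf _] _] := fi; have [[cg _] _] := gi.
split; [|exact: inj_comp|].
- apply: immersionP => [x|x]; first exact: (continuous_comp (cf x) (cg (f x))).
  have [phi aphi xphi] := matlas_cover x.
  have [psi apsi xpsi] := matlas_cover (f x).
  have [chi achi xchi] := matlas_cover (g (f x)).
  have sphi := matlas_smooth_chart aphi; have spsi := matlas_smooth_chart apsi.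
  have schi := matlas_smooth_chart achi.
  exists phi, chi; split; [by []..|].
  exact: (immersive_in_comp (cf x) xphi xpsi
    (immersion_in fi sphi spsi xphi xpsi) (immersion_in gi spsi schi xpsi xchi)).
- move=> W /fo[V /go[U oU UE] VE]; exists U => //.
  by rewrite comp_preimage UE VE.
Qed.

(** Applied with [g] the inverse of a group element or the inclusion of an open subset, it reduces
    the embedding property of [f] to smoothness. *)
Lemma smooth_embedding_left (f : M -> N) (g : N -> P) :
  smooth_map f -> smooth_map g -> smooth_embedding (g \o f) ->
  smooth_embedding f.
Proof.
move=> sf sg [gfi gfinj gfo]; have [cf _] := sf; have [cg _] := sg.
split; [|exact: inj_compr gfinj|].
- apply: immersionP => [x|x]; first exact: cf.
  have [phi aphi xphi] := matlas_cover x.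
  have [psi apsi xpsi] := matlas_cover (f x).
  have [chi achi xchi] := matlas_cover (g (f x)).
  have sphi := matlas_smooth_chart aphi; have spsi := matlas_smooth_chart apsi.
  have schi := matlas_smooth_chart achi.
  exists phi, psi; split; [by []..|].
  exact: (immersive_in_left (cf x) xphi xpsi
    (smooth_map_in sf sphi spsi xphi xpsi) (smooth_map_in sg spsi schi xpsi xchi)
    (immersion_in gfi sphi schi xphi xchi)).
- move=> W /gfo[V oV VE]; exists (g @^-1` V); last by rewrite -VE.
  by apply: open_comp => // x _; exact: cg.
Qed.

End Embeddings.

(** * Finite group actions *)

Section FixedPoints.
Context {R : realType} {n : nat} {G : finGroupType} {M : manifold R n}.
Context (act : G -> M -> M) (sact : smooth_action act).

Lemma smooth_act_continuous g : continuous (act g).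
Proof. by case: sact => _ _ /(_ g)[]. Qed.

Lemma smooth_act1 x : act 1%g x = x. Proof. by case: sact. Qed.

Lemma smooth_actM g h x : act (g * h)%g x = act g (act h x). Proof. by case: sact. Qed.

Lemma smooth_actK g : cancel (act g) (act g^-1%g).
Proof. by move=> x; rewrite -smooth_actM mulVg smooth_act1. Qed.

Lemma smooth_act_expg g x k : act g x = x -> act (g ^+ k)%g x = x.
Proof. by move=> gx; elim: k => [|k IH]; rewrite ?expg0 ?smooth_act1// expgS smooth_actM IH. Qed.

Lemma closure_fixed g (E : set M) z : (forall y, E y -> act g y = y) ->
  closure E z -> act g z = z.
Proof.
move=> gE Ez; apply: mhausdorff => A B gzA zB.
have [y [Ey [By Ay]]] : E `&` (B `&` act g @^-1` A) !=set0.
  by apply: Ez; apply: filterI => //; exact: smooth_act_continuous.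
by exists y; split=> //; rewrite -(gE y Ey).
Qed.

Lemma average_shift (W : zmodType) (F : M -> W) g w :
  \sum_(i < #[g]%g) F (act (g ^+ i)%g (act g w)) =
  \sum_(i < #[g]%g) F (act (g ^+ i)%g w).
Proof.
have := expg_order g; case: #[g]%g => [|p] gp; first by rewrite !big_ord0.
rewrite big_ord_recr big_ord_recl /= addrC; congr (_ + _).
  by rewrite -smooth_actM -expgSr gp expg0.
by apply: eq_bigr => i _; rewrite -smooth_actM -expgSr.
Qed.

(* The displacement [H] of the average of the powers of [g] has derivative 0
   at [z], by continuity from [E]; as the average is [g]-invariant, [H] moves
   by [#[g]] times the displacement of [g], which must therefore vanish. *)
Lemma closure_locally_fixed g (E : set M) z :
  (forall y, E y -> \forall w \near y, act g w = w) -> closure E z ->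
  \forall w \near z, act g w = w.
Proof.
move=> gE Ez.
have gz : act g z = z.
  by apply: closure_fixed Ez => y /gE; exact: nbhs_singleton.
have [phi aphi zphi] := matlas_cover z.
have sphi := matlas_smooth_chart aphi.
pose H y := \sum_(i < #[g]%g) (cmap phi (act (g ^+ i)%g (cinv phi y)) - y).
have HE w : cdom phi w ->
    H (cmap phi w) = \sum_(i < #[g]%g) cmap phi (act (g ^+ i)%g w)
      - cmap phi w *+ #[g]%g.
  move=> wphi; rewrite /H sumrB sumr_const card_ord.
  by congr (_ - _); apply: eq_bigr => i _; rewrite cmapK.
have sH : smooth_at H (cmap phi z).
  apply: smooth_at_sum => i; apply: smooth_atD.
    have gi : smooth_map (act (g ^+ i)%g) by case: sact.
    by apply: (smooth_map_in gi sphi sphi zphi); rewrite smooth_act_expg.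
  apply: (@smooth_at_lin _ _ _ (-%R : {linear 'rV[R]_n -> 'rV[R]_n})).
  exact: opp_continuous.
have dH v : 'D_v H (cmap phi z) = 0.
  apply/eqP; rewrite -normr_le0 leNgt; apply/negP => dH0.
  pose e := `|'D_v H (cmap phi z)| / 2.
  have e0 : 0 < e by rewrite divr_gt0.
  have /smooth_at_continuous/cvgrPdist_le/(_ e e0) := smooth_at_derive v sH.
  move=> /(near_cmap zphi) De.
  have [y [Ey [yphi Dy]]] := Ez _ (filterI (near_cdom zphi) De).
  suff Dy0 : 'D_v H (cmap phi y) = 0.
    by move: Dy; rewrite Dy0 subr0 /e; lra.
  rewrite -(derive_cst (0 : 'rV[R]_n) (cmap phi y) v); apply: near_eq_derive.
  apply: filterS2 (near_ccod yphi) (near_cinv yphi (gE y Ey)) => u uc gu.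
  rewrite /H big1// => i _.
  by rewrite smooth_act_expg// cinvK// subrr.
have dHz : differentiable H (cmap phi z) by exact: smooth_at_differentiable.
(* Any constant below 1 would serve: a displacement [u] whose multiple by the order of [g] has norm
   at most [|u| / 2] is zero. *)
have [|r r0 rP] := strict_diff sH (e := 2^-1); first by rewrite invr_gt0.
have rnear : \forall w \near z, `|cmap phi w - cmap phi z| < r.
  apply: (near_cmap (Q := fun y => `|y - cmap phi z| < r)) => //.
  by apply/nbhs_ballP; exists r => // y; rewrite -ball_normE /= distrC.
have good : nbhs z (cdom phi `&` [set w | `|cmap phi w - cmap phi z| < r]).
  exact: filterI (near_cdom zphi) rnear.
have gnear : nbhs z
    (act g @^-1` (cdom phi `&` [set w | `|cmap phi w - cmap phi z| < r])).
  have cg := @smooth_act_continuous g z; rewrite /continuous_at gz in cg.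
  exact: (cg _ good).
apply: filterS2 good gnear => w [wphi wr] [gwphi gwr].
have := rP _ _ gwr wr; rewrite -deriveE// dH subr0 !HE// average_shift.
set u := cmap phi (act g w) - _.
have -> : forall S : 'rV[R]_n, S - cmap phi (act g w) *+ #[g]%g -
    (S - cmap phi w *+ #[g]%g) = - (u *+ #[g]%g).
  by move=> S; rewrite opprB addrC addrA subrK mulrnBl opprB.
rewrite normrN => uS.
have u0 : u = 0.
  apply/eqP; rewrite -normr_le0.
  have : `|u| *+ 1 <= `|u| *+ #[g]%g by apply: ler_wpMn2l => //; exact: order_gt0.
  rewrite mulr1n -normrMn; move: uS; lra.
by rewrite -[LHS](cmapK gwphi) -[RHS](cmapK wphi) (subr0_eq u0).
Qed.

(** The points near which [g] is the identity form an open set, which is closed by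
    [closure_locally_fixed]. This is the source of effectiveness for charts restricted to an open
    set. *)
Lemma fixed_open_fixed g (Z : set M) : connected [set: M] ->
  open Z -> Z !=set0 -> (forall z, Z z -> act g z = z) ->
  forall x, act g x = x.
Proof.
move=> cM oZ [z Zz] gZ.
pose E : set M := [set y : M | \forall w \near y, act g w = w].
have oE : open E by rewrite openE => y Ey; exact: nbhs_interior.
have cE : closed E by move=> y; exact: closure_locally_fixed.
have ET : E = setT.
  apply: cM; first by exists z; exact: near_open oZ Zz gZ.
    by exists E => //; rewrite setTI.
  by exists E => //; rewrite setTI.
move=> x; have : E x by rewrite ET.
exact: nbhs_singleton.
Qed.

End FixedPoints.

(** * Star-shaped neighborhoods *)

Section SquaredNorm.
Context {R : realType} {n : nat}.
Implicit Types (u v a y : 'rV[R]_n) (f : 'rV[R]_n -> 'rV[R]_n).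

(** The norm of row vectors is the maximum norm. The squared Euclidean norm replaces it because its
    differences factor coordinatewise, which gives the second order estimate along rays. *)
Definition sqnorm u : R := \sum_j u ord0 j ^+ 2.

Lemma sqnorm_ge0 u : 0 <= sqnorm u.
Proof. by apply: sumr_ge0 => j _; exact: sqr_ge0. Qed.

Lemma le_sqnorm u : `|u| ^+ 2 <= sqnorm u.
Proof.
have [u0|u0] := eqVneq `|u| 0; first by rewrite u0 expr0n /= sqnorm_ge0.
have [[i j] /= uj] := mx_norm_neq0 u0.
have -> : `|u| = `|u ord0 j| by rewrite {1}/Num.Def.normr /= uj ord1.
rewrite real_normK ?num_real// /sqnorm (bigD1 j)//= lerDl.
by apply: sumr_ge0 => k _; exact: sqr_ge0.
Qed.

Lemma sqnorm_scale (t : R) u : sqnorm (t *: u) = t ^+ 2 * sqnorm u.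
Proof. by rewrite /sqnorm mulr_sumr; apply: eq_bigr => j _; rewrite mxE exprMn. Qed.

Definition ray a (t : R) y := a + t *: (y - a).

Lemma ray_norm a t y : 0 <= t <= 1 -> `|ray a t y - a| <= `|y - a|.
Proof.
move=> /andP[t0 t1]; rewrite /ray addrC addKr normrZ ger0_norm//.
by rewrite ler_piMl.
Qed.

(* With [w] the derivative of [f] along [y - a], the two factors of
   [u^2 - v^2 = (u - v) (u + v)] are [(1 - t) w] and [(1 + t) w] up to errors
   [e (1 - t) D] and [e (1 + t) D]. *)
Lemma sqnorm_along_ray f a : smooth_at f a -> f a = a ->
  forall eta, 0 < eta -> \forall y \near a, forall t, 0 <= t <= 1 ->
    sqnorm (f (ray a t y) - a) <=
      sqnorm (f y - a) + eta * ((1 - t ^+ 2) * `|y - a| ^+ 2).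
Proof.
move=> fa faa eta eta0.
have dfa := smooth_at_differentiable fa.
have [K K0 KP] := linear_lipschitz (diff_continuous dfa).
(* Each of the [n] coordinates contributes an error of at most [e * (2 * K + e) * ((1 - t ^+ 2) * D
   ^+ 2)], and [e <= 1] bounds the middle factor by [2 * K + 1]. The successor of [n] keeps the
   divisor positive for [n = 0]. *)
pose e := Num.min 1 (eta / (n.+1%:R * (2 * K + 1))).
have K1 : 0 < 2 * K + 1 by rewrite addr_gt0// mulr_gt0.
have nK : 0 < n.+1%:R * (2 * K + 1) :> R by rewrite mulr_gt0.
have e0 : 0 < e by rewrite lt_min ltr01 divr_gt0.
have e1 : e <= 1 by rewrite ge_min lexx.
have eeta : e * (n.+1%:R * (2 * K + 1)) <= eta.
  by rewrite -ler_pdivlMr// ge_min lexx orbT.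
have [r r0 rP] := strict_diff fa e0.
apply/nbhs_ballP; exists r => // y; rewrite -ball_normE /= distrC => yr t t01.
have tyr : `|ray a t y - a| < r by apply: le_lt_trans yr; exact: ray_norm.
have ar : `|a - a| < r by rewrite subrr normr0.
have [t0 t1] := andP t01.
set D := `|y - a| in yr *; have D0 : 0 <= D by exact: normr_ge0.
have rayE : ray a t y - a = t *: (y - a) by rewrite /ray addrC addKr.
have yrayE : y - ray a t y = (1 - t) *: (y - a).
  by rewrite /ray scalerBl scale1r opprD addrA.
have := rP _ _ yr tyr; rewrite yrayE linearZ => h1.
have := rP _ _ yr ar; rewrite faa => h2.
have := rP _ _ tyr ar; rewrite rayE faa linearZ => h3.
move: h1 h2 h3; rewrite !normrZ (ger0_norm t0) ger0_norm ?subr_ge0// -/D.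
have wK := KP (y - a); move: wK; rewrite -/D.
move: ('d f a (y - a)) => w wK; move: (f y) (f (ray a t y)) => u v h1 h2 h3.
have {}h1 j : `|u ord0 j - v ord0 j - (1 - t) * w ord0 j| <= e * ((1 - t) * D).
  by apply: le_trans h1; apply: le_trans (coord_le_norm _ j); rewrite !mxE.
have {}h2 j : `|u ord0 j - a ord0 j - w ord0 j| <= e * D.
  by apply: le_trans h2; apply: le_trans (coord_le_norm _ j); rewrite !mxE.
have {}h3 j : `|v ord0 j - a ord0 j - t * w ord0 j| <= e * (t * D).
  by apply: le_trans h3; apply: le_trans (coord_le_norm _ j); rewrite !mxE.
have {}wK j : `|w ord0 j| <= K * D by apply: le_trans (coord_le_norm _ j) wK.
have coordP j : (v ord0 j - a ord0 j) ^+ 2 <= (u ord0 j - a ord0 j) ^+ 2 +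
    e * (2 * K + 1) * ((1 - t ^+ 2) * D ^+ 2).
  move: (h1 j) (h2 j) (h3 j) (wK j).
  move: (u ord0 j) (v ord0 j) (a ord0 j) (w ord0 j) => u' v' a' w' g1 g2 g3 g4.
  pose p := u' - v' - (1 - t) * w'; pose q := u' + v' - 2 * a' - (1 + t) * w'.
  have gq : `|q| <= e * ((1 + t) * D).
    have -> : q = (u' - a' - w') + (v' - a' - t * w') by rewrite /q; ring.
    apply: le_trans (ler_normD _ _) _; lra.
  have -> : (v' - a') ^+ 2 = (u' - a') ^+ 2 -
      ((1 - t) * w' + p) * ((1 + t) * w' + q) by rewrite /p /q; ring.
  rewrite lerD2l lerNl.
  have pq : `|p * q| <= e * ((1 - t) * D) * (e * ((1 + t) * D)).
    by rewrite normrM ler_pM.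
  have wq : `|(1 - t) * w' * q| <= (1 - t) * (K * D) * (e * ((1 + t) * D)).
    rewrite normrM ler_pM// normrM ler_pM//.
    by rewrite ger0_norm// subr_ge0.
  have wp : `|(1 + t) * w' * p| <= (1 + t) * (K * D) * (e * ((1 - t) * D)).
    rewrite normrM ler_pM// normrM ler_pM//.
    by rewrite ger0_norm// addr_ge0.
  have ww : 0 <= (1 - t) * (1 + t) * w' ^+ 2.
    by rewrite mulr_ge0 ?sqr_ge0// mulr_ge0 ?subr_ge0// addr_ge0.
  have -> : ((1 - t) * w' + p) * ((1 + t) * w' + q) =
    (1 - t) * (1 + t) * w' ^+ 2 + (1 - t) * w' * q + (1 + t) * w' * p + p * q.
    ring.
  have ee : e * e * ((1 - t) * (1 + t) * D ^+ 2) <= e * ((1 - t) * (1 + t) * D ^+ 2).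
    rewrite ler_wpM2r// ?ger_pMr//.
    by rewrite mulr_ge0 ?sqr_ge0// mulr_ge0 ?subr_ge0// addr_ge0.
  move: pq wq wp; rewrite !ler_norml => /andP[pq _] /andP[wq _] /andP[wp _].
  apply: le_trans (_ : - ((1 - t) * (K * D) * (e * ((1 + t) * D)) +
     (1 + t) * (K * D) * (e * ((1 - t) * D)) +
     e * ((1 - t) * D) * (e * ((1 + t) * D))) <= _); last by lra.
  rewrite lerN2.
  apply: le_trans (_ : 2 * K * e * ((1 - t) * (1 + t) * D ^+ 2) +
    e * e * ((1 - t) * (1 + t) * D ^+ 2) <= _).
    by rewrite le_eqVlt; apply/orP; left; apply/eqP; ring.
  apply: le_trans (_ : 2 * K * e * ((1 - t) * (1 + t) * D ^+ 2) +
    e * ((1 - t) * (1 + t) * D ^+ 2) <= _); first by rewrite lerD2l.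
  by rewrite le_eqVlt; apply/orP; left; apply/eqP; ring.
have tD : 0 <= (1 - t ^+ 2) * D ^+ 2.
  by rewrite mulr_ge0 ?sqr_ge0// subr_ge0 expr_le1.
apply: le_trans (_ : \sum_(j < n) ((u ord0 j - a ord0 j) ^+ 2 +
    e * (2 * K + 1) * ((1 - t ^+ 2) * D ^+ 2)) <= _).
  by apply: ler_sum => j _; rewrite !mxE.
rewrite big_split /= sumr_const card_ord lerD//.
  by rewrite le_eqVlt; apply/orP; left; apply/eqP; apply: eq_bigr => j _; rewrite !mxE.
rewrite -[_ *+ n]mulr_natl mulrA ler_wpM2r//; apply: le_trans eeta.
rewrite mulrCA; apply: ler_wpM2l; first exact: ltW.
by apply: ler_wpM2r; [exact: ltW|rewrite ler_nat].
Qed.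

(** The summand of [i0], where [F i0] is the identity, drops by [(1 - t ^+ 2) * sqnorm (y - a)],
    hence by at least [(1 - t ^+ 2) * |y - a| ^+ 2]. Each other summand grows by at most [eta] times
    this quantity, and [eta] is small enough for the sum of all these errors. *)
Lemma sqnorm_sum_along_ray (I : finType) (i0 : I) (F : I -> 'rV[R]_n -> 'rV[R]_n) a :
  (forall i, smooth_at (F i) a) -> (forall i, F i a = a) ->
  (\forall y \near a, F i0 y = y) ->
  \forall y \near a, forall t, 0 <= t <= 1 ->
    \sum_i sqnorm (F i (ray a t y) - a) <= \sum_i sqnorm (F i y - a).
Proof.
move=> sF Fa F0; pose eta : R := #|I|.+1%:R^-1.
have eta0 : 0 < eta by rewrite invr_gt0.
have nF : \forall y \near a, forall i t, 0 <= t <= 1 ->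
    sqnorm (F i (ray a t y) - a) <=
      sqnorm (F i y - a) + eta * ((1 - t ^+ 2) * `|y - a| ^+ 2).
  by apply: near_forall => i; exact: sqnorm_along_ray.
move: F0 => /nbhs_ballP[r /= r0]; rewrite -ball_normE => rP.
have nr : \forall y \near a, `|y - a| < r.
  by apply/nbhs_ballP; exists r => // y; rewrite -ball_normE /= distrC.
apply: filterS2 nF nr => y yF yr t t01; have [t0 t1] := andP t01.
rewrite (bigD1 i0)//= [leRHS](bigD1 i0)//=.
have F0y : F i0 y = y by apply: rP; rewrite /ball_ /= distrC.
have F0t : F i0 (ray a t y) = ray a t y.
  by apply: rP; rewrite /ball_ /= distrC; apply: le_lt_trans yr; exact: ray_norm.
rewrite F0y F0t; have -> : ray a t y - a = t *: (y - a) by rewrite /ray addrC addKr.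
rewrite sqnorm_scale.
pose T := (1 - t ^+ 2) * `|y - a| ^+ 2.
have T0 : 0 <= T by rewrite mulr_ge0 ?sqr_ge0// subr_ge0 expr_le1.
have sumT : \sum_(i | i != i0) sqnorm (F i (ray a t y) - a) <=
    \sum_(i | i != i0) sqnorm (F i y - a) + T.
  apply: le_trans (_ : \sum_(i | i != i0) (sqnorm (F i y - a) + eta * T) <= _).
    by apply: ler_sum => i _; exact: yF.
  rewrite big_split /= lerD2l sumr_const -[_ *+ #|_|]mulr_natl mulrA -[leRHS]mul1r.
  rewrite ler_wpM2r// /eta ler_pdivrMr// mul1r ler_nat.
  by apply: leq_trans (max_card _) _; exact: leqnSn.
have TS : T <= (1 - t ^+ 2) * sqnorm (y - a).
  by rewrite ler_wpM2l ?le_sqnorm// subr_ge0 expr_le1.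
move: sumT TS; lra.
Qed.

End SquaredNorm.

(** * Small orbifold charts *)

Section OpenSubmanifold.
Context {R : realType} {n : nat} {M : manifold R n}.
Context (psi : coord_chart R n M) (E : set M) (x0 : M).
Hypotheses (oE : open E) (Ex0 : E x0) (Epsi : E `<=` cdom psi).

(** A left inverse of the inclusion, extended by [x0] outside [E] because the inverse map of a chart
    has to be total. *)
Definition sub_point (z : M) : E :=
  match pselect (E z) with
  | left Ez => SigSub (mem_set Ez)
  | right _ => SigSub (mem_set Ex0)
  end.

Lemma sub_pointK z : E z -> set_val (sub_point z) = z.
Proof. by rewrite /sub_point; case: pselect. Qed.

Lemma set_val_inj : injective (set_val : E -> M).
Proof. exact: val_inj. Qed.

Lemma sub_point_val (y : E) : sub_point (set_val y) = y.
Proof. by apply: set_val_inj; rewrite sub_pointK//; exact: set_valP. Qed.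

Lemma set_val_continuous : continuous (set_val : E -> M).
Proof. exact: initial_continuous. Qed.

Lemma sub_point_continuous z : E z -> {for z, continuous sub_point}.
Proof.
move=> Ez A; rewrite nbhsE => -[B [[U oU UB] Bz] BA].
apply: filterS BA _; rewrite -UB /=.
have : nbhs z (U `&` E).
  apply: open_nbhs_nbhs; split; first exact: openI.
  by split=> //; move: Bz; rewrite -UB /= sub_pointK.
by apply: filterS => w [Uw Ew]; rewrite /= sub_pointK.
Qed.

Lemma open_set_val (A : set E) :
  open A <-> exists2 U : set M, open U & A = set_val @^-1` U.
Proof. by split=> [[U oU <-]|[U oU ->]]; exists U. Qed.

Lemma set_val_image_open (A : set E) : open A -> open (set_val @` A).
Proof.
move=> /open_set_val[U oU ->].
rewrite (_ : _ @` _ = U `&` E); first exact: openI.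
apply/seteqP; split=> [_ [y Uy <-]|z [Uz Ez]].
  by split=> //; exact: set_valP.
by exists (sub_point z); rewrite /= sub_pointK.
Qed.

Let sub_cod := [set y | ccod psi y /\ E (cinv psi y)].

Lemma sub_cod_open : open sub_cod. Proof. exact: open_cinv. Qed.

Lemma sub_cmap_cod (y : E) : [set: E] y -> sub_cod (cmap psi (set_val y)).
Proof.
move=> _; have Ey := set_valP y.
by split; [exact/cmap_cod/Epsi|rewrite cmapK//; exact: Epsi].
Qed.

Lemma sub_cmapK (y : E) : [set: E] y ->
  sub_point (cinv psi (cmap psi (set_val y))) = y.
Proof.
by move=> _; rewrite cmapK ?sub_point_val//; exact/Epsi/set_valP.
Qed.

Lemma sub_cinvK y : sub_cod y -> cmap psi (set_val (sub_point (cinv psi y))) = y.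
Proof. by move=> [yc Ey]; rewrite sub_pointK// cinvK. Qed.

Lemma sub_cmap_continuous (y : E) : [set: E] y ->
  {for y, continuous (cmap psi \o set_val)}.
Proof.
move=> _; apply: continuous_comp; first exact: set_val_continuous.
exact/cmap_continuous/Epsi/set_valP.
Qed.

Lemma sub_cinv_continuous y : sub_cod y ->
  {for y, continuous (sub_point \o cinv psi)}.
Proof.
move=> [yc Ey]; apply: continuous_comp; first exact: cinv_continuous.
exact: sub_point_continuous.
Qed.

(** Since [E] lies in the domain of [psi], this one chart is already an atlas of [E]. *)
Definition sub_chart : coord_chart R n E :=
  CoordChart openT sub_cod_open sub_cmap_cod (fun _ _ => I)
    sub_cmapK sub_cinvK sub_cmap_continuous sub_cinv_continuous.

Lemma sub_hausdorff : hausdorff_space E.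
Proof.
move=> p q pq; apply: set_val_inj; apply: mhausdorff => A B pA qB.
have [r [Ar Br]] := pq _ _ (set_val_continuous pA) (set_val_continuous qB).
by exists (set_val r).
Qed.

Lemma sub_second_countable : @second_countable E.
Proof.
have [B cB [oB bB]] := @msecond_countable _ _ M.
exists [set set_val @^-1` U | U in B]; first exact: sub_countable (card_image_le _ _) cB.
split=> [_ [U BU <-]|y A].
  by apply/open_set_val; exists U => //; exact: oB.
rewrite nbhsE => -[_ [/open_set_val[U oU ->] Uy] UA].
have [V [BV Vy] VU] := bB (set_val y) _ (open_nbhs_nbhs (conj oU Uy)).
exists (set_val @^-1` V); first by split=> //; exists V.
by move=> w /VU; exact: UA.
Qed.

Lemma sub_cover (y : E) : exists2 phi, phi = sub_chart & cdom phi y.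
Proof. by exists sub_chart. Qed.

Lemma sub_smooth (phi chi : coord_chart R n E) :
  phi = sub_chart -> chi = sub_chart -> smooth_transition phi chi.
Proof.
move=> -> ->; apply: smooth_at_on => y [yc _].
apply: smooth_at_ext (smooth_at_id y).
apply: (near_open sub_cod_open yc) => z zc.
by rewrite /= sub_cinvK.
Qed.

Definition sub_manifold : manifold R n :=
  Manifold sub_hausdorff sub_second_countable sub_cover sub_smooth.

Hypothesis spsi : smooth_chart psi.

Lemma sub_chart_smooth : @smooth_chart _ _ sub_manifold sub_chart.
Proof. by apply: matlas_smooth_chart. Qed.

(** Read in [sub_chart] and [psi], the inclusion has the same coordinate expression as the identity
    of [E]. *)
Lemma immersive_set_val (y : sub_manifold) :
  immersive_in sub_chart psi (set_val : E -> M) y.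
Proof.
have yc : cdom sub_chart y by [].
have [sid iid] := immersive_in_id yc.
have E1 : \forall z \near cmap sub_chart y,
    (cmap sub_chart \o id \o cinv sub_chart) z =
    (cmap psi \o (set_val : E -> M) \o cinv sub_chart) z by near=> z.
split; first exact: smooth_at_ext E1 sid.
exact: near_eq_diff_inj E1 (smooth_at_differentiable sid) iid.
Unshelve. all: by end_near. Qed.

Lemma sub_embedding : @smooth_embedding _ _ _ sub_manifold M set_val.
Proof.
split.
- apply: immersionP => [|y]; first exact: set_val_continuous.
  exists sub_chart, psi; split; [exact: sub_chart_smooth|exact: spsi|by []| |].
    exact/Epsi/set_valP.
  exact: immersive_set_val.
- exact: set_val_inj.
- by move=> A /open_set_val[U oU ->]; exists U.
Qed.

Lemma smooth_sub_point m (N : manifold R m) (f : N -> M) :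
  (forall z, E (f z)) -> smooth_map f ->
  @smooth_map _ _ _ N sub_manifold (sub_point \o f).
Proof.
move=> Ef sf; have [cf _] := sf.
have csf : continuous (sub_point \o f).
  by move=> z; apply: continuous_comp; [exact: cf|exact: sub_point_continuous].
apply: smooth_mapP => // z; have [phi aphi zphi] := matlas_cover z.
have sphi := matlas_smooth_chart aphi.
exists phi, sub_chart; split; [exact: sphi|exact: sub_chart_smooth|by []|by []|].
have := smooth_map_in sf sphi spsi zphi (Epsi (Ef z)).
apply: smooth_at_ext; near=> w.
by rewrite /= sub_pointK.
Unshelve. all: by end_near. Qed.

Lemma sub_point_embedding m (N : manifold R m) (f : N -> M) :
  (forall z, E (f z)) -> smooth_embedding f ->
  @smooth_embedding _ _ _ N sub_manifold (sub_point \o f).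
Proof.
move=> Ef ef; have [[sf _] _ _] := ef.
have [[sv _] _ _] := sub_embedding.
apply: (@smooth_embedding_left _ _ _ _ N sub_manifold M (sub_point \o f) set_val).
- exact: smooth_sub_point.
- exact: sv.
- by have -> : set_val \o (sub_point \o f) = f
    by apply/funext => z; rewrite /= sub_pointK.
Qed.

End OpenSubmanifold.

(** * Invariant star-shaped neighborhoods of a point *)

Section GoodNeighborhood.
Context {R : realType} {n : nat} {G : finGroupType} {M : manifold R n}.
Context (act : G -> M -> M) (sact : smooth_action act) (x0 : M).

Definition stab : {set G} := [set g | act g x0 == x0].

Lemma stab_group_set : group_set stab.
Proof.
apply/group_setP; split=> [|g h]; rewrite !inE.
  by apply/eqP; exact: (smooth_act1 sact).
by move=> /eqP gx /eqP hx; rewrite (smooth_actM sact) hx gx.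
Qed.

Definition stab_group : {group G} := Group stab_group_set.

Lemma stabP g : reflect (act g x0 = x0) (g \in stab_group).
Proof. by rewrite inE; exact: eqP. Qed.

(** Hausdorffness separates [x0] from each translate [act g x0] different from it, and the
    finiteness of [G] allows intersecting over all [g]. *)
Lemma separated_nbhd : exists2 Z : set M, open Z /\ Z x0 &
  forall g z, Z z -> Z (act g z) -> act g x0 = x0.
Proof.
have /choice[Z ZP] g : exists Z : set M, [/\ open Z, Z x0 &
    forall z, Z z -> Z (act g z) -> act g x0 = x0].
  have [gx|/eqP gx] := eqVneq (act g x0) x0.
    by exists setT; split=> //; exact: openT.
  have := mhausdorff (m := M); rewrite open_hausdorff => /(_ x0 (act g x0)).
  case; first by apply/eqP => /esym.
  move=> [A B] /= [/set_mem Ax /set_mem Bgx] [oA oB /eqP AB].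
  exists (A `&` act g @^-1` B); split; [|by []|].
    by apply: openI => //; apply: open_comp => // z _; exact: smooth_act_continuous.
  move=> z [_ Bgz] [Agz _].
  by have : (A `&` B) (act g z) by []; rewrite AB.
have /open_near[A [oA Ax] AZ] : \forall z \near x0, forall g, Z g z.
  by apply: near_forall => g; case: (ZP g) => oZ Zx _; exact: open_nbhs_nbhs.
exists A => // g z Az Agz; case: (ZP g) => _ _ /(_ z).
by apply; exact: AZ.
Qed.

Context (psi : coord_chart R n M) (W : set M).
Hypotheses (spsi : smooth_chart psi) (psix0 : cdom psi x0)
  (oW : open W) (Wx0 : W x0).

(* [E] is a sublevel set of the invariant function summing the squared
   distances, read in [psi], from [x0] to the points [act h z], [h] in the
   stabilizer of [x0]. *)
Lemma good_nbhd : exists E : set M,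
  [/\ open E /\ E x0, E `<=` W, E `<=` cdom psi,
      forall g z, E z -> E (act g z) <-> act g x0 = x0 &
      forall z t, E z -> 0 <= t <= 1 ->
        exists2 z', E z' & cmap psi z' = ray (cmap psi x0) t (cmap psi z)].
Proof.
have [Z0 [oZ0 Z0x0] Z0P] := separated_nbhd.
pose Z := Z0 `&` W `&` cdom psi.
have oZ : open Z by apply: openI (cdom_open psi); exact: openI.
have Zx0 : Z x0 by [].
pose S := [subg stab_group]; pose a := cmap psi x0.
have sx0 (h : S) : act (sgval h) x0 = x0 by apply/stabP/subgP.
(* Asking for the whole stabilizer orbit to lie in [Z] makes [N] invariant under the stabilizer and
   keeps every point measured by [rho] in the domain of [psi]. *)
pose N : set M := [set z : M | forall h : S, Z (act (sgval h) z)].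
have oN : open N.
  rewrite openE => z Nz; apply: near_forall => h.
  have ch : {for z, continuous (act (sgval h))} by exact: smooth_act_continuous.
  exact: near_continuous ch oZ (Nz h).
have Nx0 : N x0 by move=> h; rewrite sx0.
have NZ : N `<=` Z by move=> z /(_ 1%g); rewrite (smooth_act1 sact).
pose F (h : S) := cmap psi \o act (sgval h) \o cinv psi.
have sF h : smooth_at (F h) a.
  have sh : smooth_map (act (sgval h)) by case: sact.
  by apply: (smooth_map_in sh spsi spsi psix0); rewrite sx0.
have Fa h : F h a = a by rewrite /F /= cmapK// sx0.
have F1 : \forall y \near a, F 1%g y = y.
  by apply: filterS (near_ccod psix0) => y yc; rewrite /F /= (smooth_act1 sact) cinvK.
pose rho z := \sum_(h : S) sqnorm (cmap psi (act (sgval h) z) - a).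
have starF := sqnorm_sum_along_ray sF Fa F1.
have Na : \forall y \near a, N (cinv psi y).
  by apply: near_cinv => //; exact: open_nbhs_nbhs.
have : nbhs a (ccod psi `&` (fun y => N (cinv psi y)) `&`
    (fun y => forall t, 0 <= t <= 1 ->
    \sum_h sqnorm (F h (ray a t y) - a) <= \sum_h sqnorm (F h y - a))).
  exact: filterI (filterI (near_ccod psix0) Na) starF.
move=> /nbhs_ballP[d /= d0]; rewrite -ball_normE => dP.
have {}dP y : `|y - a| < d -> [/\ ccod psi y, N (cinv psi y) &
    forall t, 0 <= t <= 1 ->
    \sum_h sqnorm (F h (ray a t y) - a) <= \sum_h sqnorm (F h y - a)].
  by rewrite distrC => /dP[[]].
(* The summand of the identity makes [rho z] at least [|cmap psi z - a| ^+ 2], so the level [d ^+ 2]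
   confines [E] to the ball on which [dP] holds. *)
pose E : set M := [set z : M | N z /\ rho z < d ^+ 2].
have crho z : N z -> {for z, continuous rho}.
  move=> Nz; apply: continuous_sumr => h.
  apply: (@continuous_comp _ _ _ (fun z => cmap psi (act (sgval h) z))
    (fun y => sqnorm (y - a))).
    apply: continuous_comp; first exact: smooth_act_continuous.
    by apply: cmap_continuous; have [] := Nz h.
  apply: (@smooth_at_continuous _ _ _ (fun y : 'rV[R]_n => sqnorm (y - a))).
  have sa : smooth_at (fun y : 'rV[R]_n => y - a) (cmap psi (act (sgval h) z)).
    exact: smooth_atD (smooth_at_id _) (smooth_at_cst (- a) _).
  move/smooth_at_rV: sa => sa.
  by apply: smooth_at_sum => j; exact: smooth_atM.
have rhoact g z : act g x0 = x0 -> rho (act g z) = rho z.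
  move=> /stabP gS; rewrite /rho [RHS](reindex_inj (mulIg (subg stab_group g))).
  apply: eq_bigr => h _; rewrite sgvalM ?inE//.
  by rewrite (smooth_actM sact) subgK.
have NE z : E z -> `|cmap psi z - a| < d.
  move=> [Nz rz]; rewrite -(@ltr_pXn2r _ 2)// ?nnegrE ?(ltW d0)//.
  apply: le_lt_trans (le_sqnorm _) _; apply: le_lt_trans rz.
  rewrite /rho (bigD1 1%g)//= (smooth_act1 sact) lerDl.
  by apply: sumr_ge0 => h _; exact: sqnorm_ge0.
exists E; split.
- split; last first.
    split=> //; rewrite /rho big1 ?exprn_gt0// => h _.
    by rewrite sx0 subrr /sqnorm big1// => j _; rewrite mxE expr0n.
  rewrite openE => z [Nz rz]; apply: filterI; first exact: open_nbhs_nbhs.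
  exact: near_continuous (crho z Nz) (@open_lt _ _) rz.
- by move=> z [/NZ[[]]].
- by move=> z [/NZ[[]]].
- move=> g z Ez; split=> [[Ngz _]|gx].
    have [Nz _] := Ez.
    by have [[Z0z _] _] := NZ _ Nz; have [[Z0gz _] _] := NZ _ Ngz; exact: Z0P Z0gz.
  have [Nz rz] := Ez; split; last by rewrite rhoact.
  move=> h; have gS : g \in stab_group by apply/stabP.
  by have := Nz (h * subg stab_group g)%g; rewrite sgvalM ?inE// subgK// (smooth_actM sact).
- move=> z t Ez t01; have zd := NE z Ez; have [Nz rz] := Ez.
  have zpsi : cdom psi z by have [] := NZ _ Nz.
  have td : `|ray a t (cmap psi z) - a| < d.
    by apply: le_lt_trans zd; exact: ray_norm.
  have [tc Nt _] := dP _ td; have [_ _ star] := dP _ zd.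
  exists (cinv psi (ray a t (cmap psi z))); last by rewrite cinvK.
  split=> //; apply: le_lt_trans rz; have := star t t01.
  by rewrite /F /rho /= cmapK.
Qed.

End GoodNeighborhood.

Section StarShaped.
Context {R : realType} {n : nat} {T : topologicalType}.

Lemma ray_continuous (a y : 'rV[R]_n) : continuous (fun t : R => ray a t y).
Proof.
move=> t; apply: cvgD; first exact: cvg_cst.
exact: scalel_continuous.
Qed.

Lemma ray0 (a y : 'rV[R]_n) : ray a 0 y = a.
Proof. by rewrite /ray scale0r addr0. Qed.

Lemma ray1 (a y : 'rV[R]_n) : ray a 1 y = y.
Proof. by rewrite /ray scale1r addrC subrK. Qed.

(** [A] is the union of the curves [gam z], all of which start at [x0]. *)
Lemma star_connected (phi : coord_chart R n T) (A : set T) x0 :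
  A `<=` cdom phi -> A x0 ->
  (forall z t, A z -> 0 <= t <= 1 ->
    exists2 z', A z' & cmap phi z' = ray (cmap phi x0) t (cmap phi z)) ->
  connected A.
Proof.
move=> Aphi Ax0 star.
pose gam z t := cinv phi (ray (cmap phi x0) t (cmap phi z)).
have gamA z t : A z -> 0 <= t <= 1 -> A (gam z t) /\
    ccod phi (ray (cmap phi x0) t (cmap phi z)).
  move=> Az /(star z t Az)[z' Az' z'E]; rewrite /gam -z'E cmapK; last exact: Aphi.
  by split=> //; exact/cmap_cod/Aphi.
have -> : A = \bigcup_(z in A) (gam z @` `[0, 1]).
  apply/seteqP; split=> [z Az|z [w Aw [t /=]]].
    exists z => //; exists 1; first by rewrite /= in_itv /= ler01 lexx.
    by rewrite /gam ray1 cmapK//; exact: Aphi.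
  by rewrite in_itv /= => t01 <-; have [] := gamA w t Aw t01.
apply: bigcup_connected.
  exists x0 => z Az; exists 0; first by rewrite /= in_itv /= ler01 lexx.
  by rewrite /gam ray0 cmapK//; exact: Aphi.
move=> z Az; apply: connected_continuous_connected.
  exact: segment_connected.
apply: continuous_in_subspaceT => t /set_mem; rewrite /= in_itv /= => t01.
apply: (@continuous_comp _ _ _ (fun s : R => ray (cmap phi x0) s (cmap phi z))
  (cinv phi)); first exact: ray_continuous.
by apply: cinv_continuous; have [] := gamA z t Az t01.
Qed.

End StarShaped.

(** * Restriction of an orbifold chart to such a neighborhood, with the stabilizer as group *)

Section SmallChart.
Context {R : realType} {n : nat} {X : topologicalType}.
Context (c : orbifold_chart R n X) (x0 : ocover c).
Context (psi : coord_chart R n (ocover c)) (E : set (ocover c)).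
Hypotheses (spsi : smooth_chart psi) (oE : open E) (Ex0 : E x0)
  (Epsi : E `<=` cdom psi).
Hypothesis EP : forall g z, E z -> E (oact g z) <-> oact g x0 = x0.
Hypothesis starE : forall z t, E z -> 0 <= t <= 1 ->
  exists2 z', E z' & cmap psi z' = ray (cmap psi x0) t (cmap psi z).

Let sact : smooth_action (@oact _ _ _ c) := oact_smooth c.
Let S := subg_of (stab_group sact x0).
Let mk := sub_point Ex0.

Definition small_act (h : S) (y : E) : E := mk (oact (sgval h) (set_val y)).

Definition small_proj (y : E) : X := oproj (set_val y).

Definition small_base : set X := @oproj _ _ _ c @` E.

Definition small_cover : manifold R n := sub_manifold oE Ex0 Epsi.

Lemma small_actE h y : set_val (small_act h y) = oact (sgval h) (set_val y).
Proof.
rewrite /small_act sub_pointK//; apply/EP; first exact: set_valP.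
exact/(stabP sact)/subgP.
Qed.

Lemma oproj_preimage_image (U : set (ocover c)) :
  @oproj _ _ _ c @^-1` (@oproj _ _ _ c @` U) =
  \bigcup_(g in [set: ogroup c]) (oact g @^-1` U).
Proof.
apply/seteqP; split=> [z [w Uw] /oproj_orbit[g zE]|z [g _ Ugz]].
  exists g^-1%g => //=.
  by rewrite zE (smooth_actK sact).
by exists (oact g z) => //; exact: oproj_invariant.
Qed.

Lemma oproj_open (U : set (ocover c)) : open U -> open (@oproj _ _ _ c @` U).
Proof.
move=> oU; apply/(oproj_quotient (o := c)).
  by move=> _ [z _ <-]; rewrite -(oproj_onto c); exists z.
rewrite oproj_preimage_image; apply: bigcup_open => g _.
by apply: open_comp => // z _; exact: smooth_act_continuous.
Qed.

Lemma small_base_open : open small_base. Proof. exact: oproj_open. Qed.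

Lemma small_connected : connected [set: small_cover].
Proof.
apply: (@star_connected _ _ _ (sub_chart oE Ex0 Epsi) _ (mk x0)) => // z t _ t01.
have [z' Ez' z'E] := starE (set_valP z) t01.
by exists (mk z') => //=; rewrite !sub_pointK.
Qed.

Lemma small_act_smooth : @smooth_action _ _ _ small_cover small_act.
Proof.
split=> [y|g h y|h].
- by apply: set_val_inj; rewrite small_actE (smooth_act1 sact).
- apply: set_val_inj; rewrite !small_actE sgvalM ?inE//.
  exact: (smooth_actM sact).
- have [[sv _] _ _] := sub_embedding oE Ex0 Epsi spsi.
  have [_ _ /(_ (sgval h)) sh] := sact.
  apply: (smooth_sub_point oE Ex0 Epsi spsi (N := small_cover)
    (f := oact (sgval h) \o set_val)).
    move=> y; apply/EP; first exact: set_valP.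
    exact/(stabP sact)/subgP.
  exact: (smooth_map_comp (M := small_cover) sv sh).
Qed.

Lemma small_act_effective : effective_action small_act.
Proof.
move=> h hE; apply: val_inj; apply: (oact_effective (o := c)).
apply: (fixed_open_fixed sact (ocover_connected (o := c)) oE); first by exists x0.
move=> z Ez; have := congr1 set_val (hE (mk z)).
by rewrite small_actE sub_pointK.
Qed.

Lemma small_proj_continuous : continuous small_proj.
Proof.
move=> y; apply: continuous_comp; first exact: set_val_continuous.
exact: oproj_continuous.
Qed.

Lemma small_proj_invariant h y : small_proj (small_act h y) = small_proj y.
Proof. by rewrite /small_proj small_actE oproj_invariant. Qed.

Lemma small_proj_onto : range small_proj = small_base.
Proof.
apply/seteqP; split=> [_ [y _ <-]|_ [z Ez <-]].
  by exists (set_val y) => //; exact: set_valP.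
by exists (mk z) => //; rewrite /small_proj sub_pointK.
Qed.

Lemma small_proj_orbit x y : small_proj x = small_proj y ->
  exists h, y = small_act h x.
Proof.
move=> /oproj_orbit[g yE]; have gx0 : oact g x0 = x0.
  by apply/(EP _ (set_valP x)); rewrite -yE; exact: set_valP.
exists (subg (stab_group sact x0) g); apply: set_val_inj.
by rewrite small_actE subgK//; exact/(stabP sact).
Qed.

Lemma small_proj_quotient (W : set X) : W `<=` small_base ->
  (open W <-> open (small_proj @^-1` W)).
Proof.
move=> WB; split=> [oW|/(set_val_image_open oE Ex0) oW].
  by apply: open_comp => // y _; exact: small_proj_continuous.
have -> : W = @oproj _ _ _ c @` (set_val @` (small_proj @^-1` W)).
  apply/seteqP; split=> [p Wp|_ [_ [y Wy <-] <-]//].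
  have [z Ez zp] := WB p Wp.
  exists z => //; exists (mk z); last exact: sub_pointK.
  by rewrite /= /small_proj sub_pointK// zp.
exact/oproj_open/oW.
Qed.

Definition small_chart : orbifold_chart R n X :=
  @OrbifoldChart R n X small_base small_cover S small_act small_proj
    small_base_open small_connected small_act_smooth small_act_effective
    small_proj_continuous small_proj_invariant small_proj_onto
    small_proj_orbit small_proj_quotient.

Lemma small_injection : @orbifold_injection _ _ _ small_chart c set_val.
Proof.
split=> //; last exact: sub_embedding.
by move=> _ [z _ <-]; rewrite -(oproj_onto c); exists z.
Qed.

End SmallChart.

Section Actions.
Context {R : realType} {n : nat} {M : manifold R n}.

Lemma smooth_embedding_id : smooth_embedding (id : M -> M).
Proof.
split=> //; last by move=> W oW; exists W.
apply: immersionP => [x|x]; first by [].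
have [phi aphi xphi] := matlas_cover x.
have sphi := matlas_smooth_chart aphi.
by exists phi, phi; split=> //; exact: immersive_in_id.
Qed.

Lemma act_embedding (G : finGroupType) (act : G -> M -> M) g :
  smooth_action act -> smooth_embedding (act g).
Proof.
move=> sact; have [_ _ smact] := sact.
apply: (smooth_embedding_left (g := act g^-1%g)) => //.
have -> : act g^-1%g \o act g = id by apply/funext => x; exact: smooth_actK.
exact: smooth_embedding_id.
Qed.

End Actions.

(** * Restricted charts belong to the maximal atlas *)

Section Compatibility.
Context {R : realType} {n : nat} {X : topologicalType}.
Implicit Types c : orbifold_chart R n X.

Lemma compatible_at_sym c1 c2 q : compatible_at c1 c2 q -> compatible_at c2 c1 q.
Proof. by move=> [c [cq cc l1 l2]]; exists c; split=> // p /cc[]. Qed.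

Lemma oproj_base c (z : ocover c) : obase c (oproj z).
Proof. by rewrite -(oproj_onto c); exists z. Qed.

Lemma oproj_surj c p : obase c p -> exists z, oproj (o := c) z = p.
Proof. by rewrite -(oproj_onto c) => -[z _ <-]; exists z. Qed.

(** Two lifts of the same point differ by a group element; following the injection by that element
    corrects its value at [y]. *)
Lemma injection_at c c' (lam : ocover c' -> ocover c) (y : ocover c') (x : ocover c) :
  orbifold_injection lam -> oproj y = oproj x :> X ->
  exists F : ocover c' -> ocover c,
    [/\ smooth_embedding F, forall z, oproj (F z) = oproj z & F y = x].
Proof.
move=> [_ elam plam] yx; have [g xE] : exists g, x = oact g (lam y).
  by apply: oproj_orbit; rewrite plam.
exists (oact g \o lam); split=> //; last by move=> z; rewrite /= oproj_invariant.
apply: smooth_embedding_comp => //.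
exact/act_embedding/oact_smooth.
Qed.

Section Small.
Context (c : orbifold_chart R n X) (x0 : ocover c).
Context (psi : coord_chart R n (ocover c)) (E : set (ocover c)).
Hypotheses (spsi : smooth_chart psi) (oE : open E) (Ex0 : E x0)
  (Epsi : E `<=` cdom psi).
Hypothesis EP : forall g z, E z -> E (oact g z) <-> oact g x0 = x0.
Hypothesis starE : forall z t, E z -> 0 <= t <= 1 ->
  exists2 z', E z' & cmap psi z' = ray (cmap psi x0) t (cmap psi z).

(** The common chart [c2] of [c] and [c1] may be mapped outside [E]. Its injection into [c] is moved
    so that a lift of [q] lands in [E], and [c2] is restricted around that lift to a small chart
    whose cover is mapped into [E]. *)
Lemma small_chart_compatible c1 q : compatible_at c c1 q -> (@oproj _ _ _ c @` E) q ->
  compatible_at (small_chart spsi oE Ex0 Epsi EP starE) c1 q.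
Proof.
move=> [c2 [c2q c2sub [lam ilam] [lam1 ilam1]]] [x Ex xq].
have [y yq] := oproj_surj c2q.
have [F [eF pF Fy]] := injection_at ilam (etrans yq (esym xq)).
have [[[cF _] _] _ _] := eF.
have [chi achi ychi] := matlas_cover y.
have schi := matlas_smooth_chart achi.
have oW : open (F @^-1` E) by apply: open_comp => // z _; exact: cF.
have Wy : (F @^-1` E) y by rewrite /= Fy.
have [E2 [[oE2 E2y] E2W E2chi E2P star2]] :=
  good_nbhd (oact_smooth c2) schi ychi oW Wy.
pose d := small_chart schi oE2 E2y E2chi E2P star2.
have [_ emb2 _] := small_injection schi oE2 E2y E2chi E2P star2.
have [_ elam1 plam1] := ilam1.
have [[[sF _] _ _] [[sv _] _ _]] := (eF, emb2).
exists d; split.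
- by exists y.
- move=> _ [z E2z <-]; split; last by have [] := c2sub _ (oproj_base z).
  by exists (F z); [exact: E2W|exact: pF].
- have EF (z : E2) : E ((F \o set_val) z) by exact/E2W/set_valP.
  exists (sub_point Ex0 \o (F \o set_val)); split.
  + move=> _ [z E2z <-]; exists (F z); [exact: E2W|exact: pF].
  + apply: (sub_point_embedding oE Ex0 Epsi spsi (N := ocover d)) => //.
    exact: smooth_embedding_comp emb2 eF.
  + move=> z; rewrite /= /small_proj sub_pointK; last exact: EF.
    exact: pF.
- exists (lam1 \o set_val); split.
  + by move=> _ [z E2z <-]; have [] := c2sub _ (oproj_base z).
  + exact: smooth_embedding_comp emb2 elam1.
  + by move=> z; rewrite /= plam1.
Qed.

End Small.
End Compatibility.

Section Atlas.
Context {R : realType} {n : nat} (O : orbifold R n).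
Context (c : orbifold_chart R n O) (ac : oatlas c) (x0 : ocover c).
Context (psi : coord_chart R n (ocover c)) (E : set (ocover c)).
Hypotheses (spsi : smooth_chart psi) (oE : open E) (Ex0 : E x0)
  (Epsi : E `<=` cdom psi).
Hypothesis EP : forall g z, E z -> E (oact g z) <-> oact g x0 = x0.
Hypothesis starE : forall z t, E z -> 0 <= t <= 1 ->
  exists2 z', E z' & cmap psi z' = ray (cmap psi x0) t (cmap psi z).

(** By maximality it is enough that adjoining the chart leaves an atlas. Compatibility of the chart
    with itself follows by using [small_chart_compatible] once for each of the two arguments. *)
Lemma small_chart_atlas : oatlas (small_chart spsi oE Ex0 Epsi EP starE).
Proof.
set d := small_chart _ _ _ _ _ _.
have [cov comp] := oatlasP O.
have dc q : obase d q -> obase c q by move=> [z _ <-]; exact: oproj_base.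
have dcomp c1 q : oatlas c1 -> obase d q -> obase c1 q -> compatible_at d c1 q.
  by move=> ac1 dq c1q; apply: small_chart_compatible => //; apply: comp => //; exact: dc.
apply: (oatlas_maximal (A := fun e => oatlas e \/ e = d)); [|by left|by right].
split=> [p|c1 c2].
  by have [e ae ep] := cov p; exists e => //; left.
move=> [a1|->] [a2|->] q q1 q2.
- exact: comp.
- exact/compatible_at_sym/dcomp.
- exact: dcomp.
- apply: small_chart_compatible => //; apply: compatible_at_sym.
  by apply: dcomp => //; exact: dc.
Qed.

End Atlas.

(** * Transverse intersections *)

Section Equations.
Context {R : realType} {n : nat} (O : orbifold R n).

Lemma full_submanifold_near (c : orbifold_chart R n O) (D : {group ogroup c})
    m (V : set (ocover c)) (P : set O) x :
  full_submanifold (@oact _ _ _ c) D m V -> closed V ->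
  open_in P (@oproj _ _ _ c @` V) -> V x ->
  \forall z \near x, P (oproj z) <-> V z.
Proof.
move=> [_ DV fV] cV [W oW VW] Vx.
have PV z : V z -> P (oproj z) /\ W (oproj z).
  by move=> Vz; have : (P `&` W) (oproj z) by rewrite -VW; exists z.
have nW : \forall z \near x, W (oproj z).
  have cp : {for x, continuous (@oproj _ _ _ c)} by exact: oproj_continuous.
  by apply: near_continuous cp oW _; have [] := PV x Vx.
(* If [oact g x] lies in [V], fullness at [x] puts [g] into [D]; otherwise closedness of [V] keeps
   [oact g z] off [V] for [z] near [x]. *)
have nD : \forall z \near x, forall g, V (oact g z) -> g \in D.
  apply: near_forall => g; have [Vgx|nVgx] := pselect (V (oact g x)).
    by apply: nearW => z _; exact: fV Vgx.
  have cg : {for x, continuous (oact g)}.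
    exact/smooth_act_continuous/oact_smooth.
  have oV : open (~` V) by exact: closed_openC.
  by apply: filterS (near_continuous cg oV nVgx).
apply: filterS2 nW nD => z Wz Dz; split=> [Pz|/PV[]//].
have [v Vv /oproj_orbit[g vE]] : (@oproj _ _ _ c @` V) (oproj z).
  by rewrite VW.
have [h zE] : exists h, v = oact h z.
  by exists g^-1%g; rewrite vE (smooth_actK (oact_smooth c)).
have Vhz : V (oact h z) by rewrite -zE.
have hD := Dz h Vhz; rewrite -(smooth_actK (oact_smooth c) h z).
by apply: DV => //; rewrite groupV.
Qed.

Lemma suborbifold_equations k (P : set O) (c : orbifold_chart R n O)
    (x : ocover c) (phi : coord_chart R n (ocover c)) :
  full_suborbifold k P -> oatlas c -> P (oproj x) -> smooth_chart phi ->
  cdom phi x ->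
  exists2 m : nat, k = m%:Z /\ (m <= n)%N &
  exists (B : set 'rV[R]_n) (F : 'rV[R]_n -> 'rV[R]_n),
    [/\ open B /\ B (cmap phi x), B `<=` ccod phi,
    smooth_at F (cmap phi x), injective ('d F (cmap phi x)) &
    forall y, B y -> P (oproj (cinv phi y)) <->
      forall i : 'I_n, (m <= i)%N -> F y ord0 i = 0].
Proof.
move=> fP ac Px sphi xphi.
have [c1 [D [m [V [ac1 kE fV [_ cV] [oV [x1 Vx1 x1p]]]]]]] := fP _ Px.
have [sV _ _] := fV.
have [mn [theta [stheta x1theta thetaP]]] := sV _ Vx1.
exists m => //.
have [_ comp] := oatlasP O.
have xc : obase c (oproj x) by exact: oproj_base.
have xc1 : obase c1 (oproj x) by rewrite -x1p; exact: oproj_base.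
have [c2 [c2x _ [lam ilam] [lam1 ilam1]]] := comp _ _ ac ac1 _ xc xc1.
have [y yx] := oproj_surj c2x.
have [F0 [[iF0 _ _] pF0 F0y]] := injection_at ilam yx.
have [F1 [[iF1 _ _] pF1 F1y]] := injection_at ilam1 (etrans yx (esym x1p)).
have [[cF0 _] _] := iF0; have [[cF1 _] _] := iF1.
have [chi achi ychi] := matlas_cover y.
have schi := matlas_smooth_chart achi.
(* Coordinate expressions of the two injections, moved by group elements so that [y] goes to [x] and
   to [x1]. As all dimensions are equal, an injective derivative makes them local
   diffeomorphisms. *)
pose L0 := cmap phi \o F0 \o cinv chi; pose L1 := cmap theta \o F1 \o cinv chi.
have F0ydom : cdom phi (F0 y) by rewrite F0y.
have F1ydom : cdom theta (F1 y) by rewrite F1y.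
have [sL0 iL0] := immersion_in iF0 schi sphi ychi F0ydom.
have [sL1 iL1] := immersion_in iF1 schi stheta ychi F1ydom.
have nearV := full_submanifold_near fV cV oV Vx1.
have n0 : \forall z \near y, cdom phi (F0 z).
  exact: near_continuous (cF0 y) (cdom_open phi) F0ydom.
have n1 : \forall z \near y, cdom theta (F1 z).
  exact: near_continuous (cF1 y) (cdom_open theta) F1ydom.
have nV : \forall z \near y, P (oproj (F1 z)) <-> V (F1 z).
  have c1y := cF1 y; rewrite /continuous_at F1y in c1y.
  exact: (c1y [set z | P (oproj z) <-> V z]).
have nA : nbhs (cmap chi y) (fun u => [/\ ccod chi u,
    cdom phi (F0 (cinv chi u)), cdom theta (F1 (cinv chi u)) &
    P (oproj (F1 (cinv chi u))) <-> V (F1 (cinv chi u))]).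
  apply: filterS2 (filterI (near_ccod ychi) (near_cinv ychi n0))
    (filterI (near_cinv ychi n1) (near_cinv ychi nV)).
  by move=> u [? ?] [? ?].
have [B0 [g [[oB0 B0y] B0A oLB gL smooth_gL]]] := inverse_function nA sL0 iL0.
have L0y : L0 (cmap chi y) = cmap phi x by rewrite /L0 /= cmapK// F0y.
have gx : g (cmap phi x) = cmap chi y by rewrite -L0y; exact: gL.
have [_ sg] := smooth_gL _ B0y.
have {}sg : smooth_at g (cmap phi x) by rewrite -L0y; exact: sg.
have sL1g : smooth_at L1 (g (cmap phi x)) by rewrite gx; exact: sL1.
have LBx : (L0 @` B0) (cmap phi x) by rewrite -L0y; exists (cmap chi y).
have ig : injective ('d g (cmap phi x)).
  have dL0 : differentiable L0 (cmap chi y) by exact: smooth_at_differentiable.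
  apply: (diff_left_inverse_inj gx (smooth_at_differentiable sg) dL0).
  apply: (near_open oLB LBx) => _ [u B0u <-].
  by rewrite gL.
(* From [phi] back to the common chart by the local inverse [g] of [L0], then on to the slice chart
   [theta], where [V] is given by the vanishing of the last coordinates. *)
exists (L0 @` B0), (L1 \o g); split; [by []|..].
- move=> _ [u /B0A[uc u0 _ _] <-]; exact: cmap_cod.
- exact: smooth_at_comp.
- exact: (diff_comp_inj gx (smooth_at_differentiable sg)
    (smooth_at_differentiable sL1) ig iL1).
- move=> _ [u B0u <-]; have [uc u0 u1 uV] := B0A _ B0u.
  have thu := thetaP _ u1.
  rewrite /L0 /= cmapK// pF0 -pF1 -[g _]/(g (L0 u)) gL//.
  exact: iff_trans uV thu.
Qed.

End Equations.

(** * Joining two transverse systems of linear equations *)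

Section LinearAlgebra.
Context {R : realType}.

Lemma mulmx_shift (n r m : nat) (S : 'M[R]_(n, r)) :
  (m + r)%N = n -> S = \matrix_(i, j) (i == m + j :> nat)%:R ->
  forall u : 'rV[R]_n, u *m S = 0 <-> forall i : 'I_n, (m <= i)%N -> u ord0 i = 0.
Proof.
move=> mrn SE u; have uS (j : 'I_r) (i : 'I_n) :
    i = (m + j)%N :> nat -> (u *m S) ord0 j = u ord0 i.
  move=> ij; rewrite mxE (bigD1 i)//= big1 => [|k ki]; rewrite SE mxE.
    by rewrite ij eqxx mulr1 addr0.
  case: eqP => [kj|]; last by rewrite mulr0.
  by case/eqP: ki; apply: val_inj; rewrite /= kj ij.
split=> [uS0 i mi|u0].
  have ir : (i - m < r)%N by rewrite ltn_subLR// mrn.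
  by rewrite -(uS (Ordinal ir)) ?uS0 ?mxE//= subnKC.
apply/rowP => j; rewrite [RHS]mxE.
have jn : (m + j < n)%N by rewrite -mrn ltn_add2l.
by rewrite (uS j (Ordinal jn))// u0//= leq_addr.
Qed.

Lemma trmx_shift_mul (n r m : nat) (S : 'M[R]_(n, r)) :
  (m + r)%N = n -> S = \matrix_(i, j) (i == m + j :> nat)%:R -> S^T *m S = 1%:M.
Proof.
move=> mrn SE; apply/matrixP => a b; rewrite !mxE.
have an : (m + a < n)%N by rewrite -mrn ltn_add2l.
rewrite (bigD1 (Ordinal an))//= big1 => [|k ka].
  by rewrite addr0 !SE !mxE /= eqxx mul1r eqn_add2l.
rewrite SE !mxE; case: eqP => [kE|]; last by rewrite mul0r.
by case/eqP: ka; apply: val_inj.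
Qed.

(* [T1] and [T2] read off the last [n - m1] and [n - m2] coordinates and put
   them side by side in the last [n - m] places; [K] fills the first [m] ones. *)
Lemma transverse_equations n m1 m2 (J1 J2 : 'M[R]_n) :
  (m1 <= n)%N -> (m2 <= n)%N -> J1 \in unitmx -> J2 \in unitmx ->
  (forall w : 'rV[R]_n, exists v1 v2,
    [/\ forall i : 'I_n, (m1 <= i)%N -> (v1 *m J1) ord0 i = 0,
        forall i : 'I_n, (m2 <= i)%N -> (v2 *m J2) ord0 i = 0 & w = v1 + v2]) ->
  exists m (K T1 T2 : 'M[R]_n),
    [/\ (m + n = m1 + m2)%N, (m <= n)%N, K + J1 *m T1 + J2 *m T2 \in unitmx &
      forall y u1 u2 : 'rV[R]_n,
      (forall i : 'I_n, (m <= i)%N -> (y *m K + u1 *m T1 + u2 *m T2) ord0 i = 0) <->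
      (forall i : 'I_n, (m1 <= i)%N -> u1 ord0 i = 0) /\
      (forall i : 'I_n, (m2 <= i)%N -> u2 ord0 i = 0)].
Proof.
move=> m1n m2n uJ1 uJ2 transv.
pose S1 : 'M[R]_(n, n - m1) := \matrix_(i, j) (i == m1 + j :> nat)%:R.
pose S2 : 'M[R]_(n, n - m2) := \matrix_(i, j) (i == m2 + j :> nat)%:R.
have S1P := mulmx_shift (subnKC m1n) (erefl S1).
have S2P := mulmx_shift (subnKC m2n) (erefl S2).
pose N := row_mx (J1 *m S1) (J2 *m S2).
(* For a target [(a, b)] choose [u1] over [a] and [u2] over [b], and split [u1 - u2 = t1 + t2] into
   the two kernels; the vector [u1 - t1 = u2 + t2] then lies over both. *)
have fullN : row_full N.
  rewrite -sub1mx; apply/row_subP => i; move: (row i _) => w.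
  rewrite -[w]hsubmxK; move: (lsubmx w) (rsubmx w) => a b.
  pose u1 := a *m S1^T *m invmx J1; pose u2 := b *m S2^T *m invmx J2.
  have u1E : u1 *m (J1 *m S1) = a.
    by rewrite mulmxA mulmxKV// -mulmxA (trmx_shift_mul (subnKC m1n)) ?mulmx1.
  have u2E : u2 *m (J2 *m S2) = b.
    by rewrite mulmxA mulmxKV// -mulmxA (trmx_shift_mul (subnKC m2n)) ?mulmx1.
  have [t1 [t2 [/S1P t1S /S2P t2S uE]]] := transv (u1 - u2).
  have E1 : (u1 - t1) *m (J1 *m S1) = a by rewrite mulmxBl u1E mulmxA t1S subr0.
  have E2 : (u1 - t1) *m (J2 *m S2) = b.
    have -> : u1 - t1 = u2 + t2.
      apply/rowP => k; have := congr1 (fun u : 'rV[R]_n => u ord0 k) uE.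
      by rewrite !mxE; lra.
    by rewrite mulmxDl u2E mulmxA t2S addr0.
  by rewrite -{1}E1 -{1}E2 -mul_mx_row submxMl.
pose r := ((n - m1) + (n - m2))%N.
have rankN : \rank N = r by apply/eqP.
(* Because of this bound the subtraction defining [m] does not truncate, and [m + n = m1 + m2] is an
   honest equation. *)
have rn : (r <= n)%N by rewrite -rankN rank_leq_row.
pose m := (n - r)%N.
have mrn : (m + r)%N = n by exact: subnK.
pose T : 'M[R]_(r, n) := (\matrix_(i, j) (i == m + j :> nat)%:R)^T.
have TE (w : 'rV[R]_r) (j : 'I_r) (i : 'I_n) :
    i = (m + j)%N :> nat -> (w *m T) ord0 i = w ord0 j.
  move=> ij; rewrite mxE (bigD1 j)//= big1 => [|k kj]; rewrite !mxE.
    by rewrite ij eqxx mulr1 addr0.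
  rewrite ij eqn_add2l; case: eqP => [jk|]; last by rewrite mulr0.
  by case/eqP: kj; apply: val_inj.
have T0 (w : 'rV[R]_r) (i : 'I_n) : (i < m)%N -> (w *m T) ord0 i = 0.
  move=> im; rewrite mxE big1// => k _; rewrite !mxE.
  by case: eqP => [iE|]; [move: im; rewrite iE ltnNge leq_addr|rewrite mulr0].
have TP (w : 'rV[R]_r) : (forall i : 'I_n, (m <= i)%N -> (w *m T) ord0 i = 0) -> w = 0.
  move=> wT; apply/rowP => j; rewrite [RHS]mxE.
  have jn : (m + j < n)%N by rewrite -mrn ltn_add2l.
  by rewrite -(TE w j (Ordinal jn))// wT//= leq_addr.
pose B := row_base (kermx N).
have rankB : \rank (kermx N) = m by rewrite mxrank_ker rankN.
(* On the kernel of [N] this writes the coordinates in the basis [B] into the first [m] places. A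
   vector killed by the combined matrix has [v *m N = 0] by the last places, so it lies in that
   kernel, and then its coordinates vanish by the first places. *)
pose K : 'M[R]_n := pinvmx B *m (pid_mx m : 'M[R]_(_, n)).
have K0 (v : 'rV[R]_n) (i : 'I_n) : (m <= i)%N -> (v *m K) ord0 i = 0.
  move=> mi; rewrite mulmxA mxE big1// => k _; rewrite [pid_mx _ _ _]mxE.
  have km : (k < m)%N by rewrite -rankB.
  by case: eqP => [kE|]; [move: km; rewrite kE ltnNge mi|rewrite mulr0].
pose T1 := S1 *m usubmx T; pose T2 := S2 *m dsubmx T.
have TT (u1 u2 : 'rV[R]_n) : u1 *m T1 + u2 *m T2 = row_mx (u1 *m S1) (u2 *m S2) *m T.
  by rewrite -[in RHS](vsubmxK T) mul_row_col !mulmxA.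
exists m, K, T1, T2; split.
- by move: mrn; rewrite /r; lia.
- exact: leq_subr.
- rewrite -row_free_unit -kermx_eq0; apply/eqP/row_matrixP => i; rewrite row0.
  have : row i (kermx (K + J1 *m T1 + J2 *m T2)) *m (K + J1 *m T1 + J2 *m T2) = 0.
    by rewrite -row_mul mulmx_ker row0.
  move: (row i _) => v; rewrite !mulmxDr (mulmxA v J1) (mulmxA v J2) -addrA TT => vQ.
  have vN : row_mx (v *m J1 *m S1) (v *m J2 *m S2) = v *m N.
    by rewrite mul_mx_row !mulmxA.
  rewrite vN in vQ.
  have vN0 : v *m N = 0.
    apply: TP => j mj; have := congr1 (fun u : 'rV[R]_n => u ord0 j) vQ.
    by rewrite [LHS]mxE K0// add0r => ->; rewrite mxE.
  move: vQ; rewrite vN0 mul0mx addr0.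
  have : (v <= B)%MS by rewrite eq_row_base; apply/sub_kermxP.
  move=> /submxP[a ->]; rewrite /K mulmxA (mulmxKp (row_base_free _)) => aK.
  suff -> : a = 0 by rewrite mul0mx.
  apply/rowP => k; rewrite [RHS]mxE.
  have km : (k < m)%N by rewrite -rankB.
  have kn : (k < n)%N by apply: leq_trans km _; exact: leq_subr.
  have := congr1 (fun u : 'rV[R]_n => u ord0 (Ordinal kn)) aK.
  rewrite [RHS]mxE mxE (bigD1 k)//= big1 => [|l lk]; rewrite !mxE /=.
    by rewrite eqxx km mulr1 addr0.
  by case: eqP => [lE|]; [case/eqP: lk; apply: val_inj|rewrite mulr0].
- move=> y u1 u2; rewrite -addrA TT -(S1P u1) -(S2P u2); split=> [yu|[-> ->] i mi].
    suff /eq_row_mx : row_mx (u1 *m S1) (u2 *m S2) = row_mx 0 0 by [].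
    rewrite row_mx0; apply: TP => i mi.
    by have := yu i mi; rewrite [LHS]mxE K0// add0r.
  by rewrite row_mx0 mul0mx addr0 K0.
Qed.

End LinearAlgebra.

Section LocalDiffeoChart.
Context {R : realType} {n : nat} {M : manifold R n}.

(** The inverse function theorem makes [f] a diffeomorphism of a neighborhood contained in [A], and
    [psi] is [phi] followed by it. The set [A] will be the region where the equations of both
    suborbifolds are valid. *)
Lemma local_diffeo_chart (phi : coord_chart R n M) (x : M) (A : set 'rV[R]_n)
    (f : 'rV[R]_n -> 'rV[R]_n) :
  smooth_chart phi -> cdom phi x -> nbhs (cmap phi x) A ->
  smooth_at f (cmap phi x) -> injective ('d f (cmap phi x)) ->
  exists psi : coord_chart R n M, [/\ smooth_chart psi, cdom psi x &
    forall z, cdom psi z ->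
      [/\ cdom phi z, A (cmap phi z) & cmap psi z = f (cmap phi z)]].
Proof.
move=> sphi xphi xA sf inf.
have xA' : nbhs (cmap phi x) (A `&` ccod phi) by exact: filterI (near_ccod xphi).
have [B [g [[oB Bx] BA ofB gf sfg]]] := inverse_function xA' sf inf.
pose dom := [set z | cdom phi z /\ B (cmap phi z)].
have odom : open dom by exact: open_cmap.
have gB y : (f @` B) y -> [/\ B (g y), ccod phi (g y) & f (g y) = y].
  by move=> [u Bu <-]; rewrite gf//; have [] := BA _ Bu.
have cod z : dom z -> (f @` B) ((f \o cmap phi) z).
  by move=> [_ Bz]; exists (cmap phi z).
have dm y : (f @` B) y -> dom ((cinv phi \o g) y).
  by move=> /gB[Bg cg _]; split; [exact: cinv_dom|rewrite /= cinvK].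
have K1 z : dom z -> (cinv phi \o g) ((f \o cmap phi) z) = z.
  by move=> [zphi Bz]; rewrite /= gf// cmapK.
have K2 y : (f @` B) y -> (f \o cmap phi) ((cinv phi \o g) y) = y.
  by move=> /gB[_ cg fg]; rewrite /= cinvK.
have C1 z : dom z -> {for z, continuous (f \o cmap phi)}.
  move=> [zphi Bz]; apply: continuous_comp; first exact: cmap_continuous.
  by apply: smooth_at_continuous; have [] := sfg _ Bz.
have C2 y : (f @` B) y -> {for y, continuous (cinv phi \o g)}.
  move=> fBy; apply: continuous_comp.
    by apply: smooth_at_continuous; case: fBy => u Bu <-; have [] := sfg _ Bu.
  by apply: cinv_continuous; have [] := gB _ fBy.
exists (CoordChart odom ofB cod dm K1 K2 C1 C2); split=> //.
- move=> chi achi; have schi := matlas_smooth_chart achi.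
  split; apply/smooth_transitionP => z.
    move=> [zphi Bz] zchi.
    have [_ sg] := sfg _ Bz.
    apply: (smooth_at_comp (f := g) (g := cmap chi \o id \o cinv phi)) => //.
    by rewrite /= gf//; exact: smooth_in_id.
  move=> zchi [zphi Bz].
  apply: (smooth_at_comp (f := cmap phi \o id \o cinv chi) (g := f)).
    exact: smooth_in_id.
  by rewrite /= cmapK//; have [] := sfg _ Bz.
- by move=> z [zphi Bz]; split=> //; have [] := BA _ Bz.
Qed.

(** Along a curve in [N] the component [i] of [F] vanishes for times near 0, so its derivative does
    too. It applies to the submanifolds given by transversality because they lie over the
    suborbifolds. *)
Lemma tangent_space_kernel (N : set M) (phi : coord_chart R n M) x v
    (B : set 'rV[R]_n) (F : 'rV[R]_n -> 'rV[R]_n) (i : 'I_n) :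
  tangent_space N phi x v -> open B -> B (cmap phi x) ->
  smooth_at F (cmap phi x) ->
  (forall z, N z -> cdom phi z -> B (cmap phi z) -> F (cmap phi z) ord0 i = 0) ->
  (v *m 'J F (cmap phi x)) ord0 i = 0.
Proof.
move=> [c [e [e0 c0 cN sc ->]]] oB Bx sF FN.
pose gam : R -> 'rV[R]_n := cmap phi \o c.
have gam0 : gam 0 = cmap phi x by rewrite /gam /= c0.
have e00 : `|0 : R| < e by rewrite normr0.
have dgam : differentiable gam (0 : R) by have [+ _] := sc 1%N; exact.
have cgam := differentiable_continuous dgam.
have dF : differentiable F (gam 0).
  by rewrite gam0; exact: smooth_at_differentiable.
have dFg : differentiable (F \o gam) (0 : R) by exact: differentiable_comp.
have -> : 'D_1 (cmap phi \o c) 0 *m 'J F (cmap phi x) = 'D_1 (F \o gam) (0 : R).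
  have dE : 'd (F \o gam) (0 : R) 1 = 'd F (gam 0) ('d gam (0 : R) 1).
    exact: (congr1 (fun L : R -> 'rV[R]_n => L 1) (diff_comp dgam dF)).
  rewrite (deriveE _ dFg) dE -(deriveE _ dgam) -gam0.
  exact: mul_rV_lin1.
have nB : \forall t \near (0 : R), B (gam t).
  by apply: near_continuous cgam oB _; rewrite gam0.
have ne : \forall t \near (0 : R), `|t| < e.
  by apply/nbhs_ballP; exists e => // t; rewrite -ball_normE /= sub0r normrN.
have nF : \forall t \near (0 : R), (F \o gam) t ord0 i = cst 0 t.
  by apply: filterS2 nB ne => t Bt /cN[Nct cct]; exact: FN.
rewrite (derive_rV _ _ dFg) (near_eq_derive (1 : R) nF).
exact: derive_cst.
Qed.

End LocalDiffeoChart.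

Section LinearSlice.
Context {R : realType} {n : nat} (O : orbifold R n).
Context (c : orbifold_chart R n O) (ac : oatlas c) (x0 : ocover c).
Context (psi : coord_chart R n (ocover c)).
Hypotheses (spsi : smooth_chart psi) (psix0 : cdom psi x0).

(* In a small chart around [x0] the preimage of [P] is a linear slice, which is
   a full submanifold for the whole group of that chart. *)
Lemma linear_slice_suborbifold (P : set O) (m : nat) : (m <= n)%N ->
  P (oproj x0) ->
  (forall z, cdom psi z ->
    P (oproj z) <-> forall i : 'I_n, (m <= i)%N -> cmap psi z ord0 i = 0) ->
  exists (d : orbifold_chart R n O) (D : {group ogroup d}) (V : set (ocover d)),
      [/\ oatlas d, full_submanifold (@oact _ _ _ d) D m V,
          connected V /\ closed V &
          open_in P (@oproj _ _ _ d @` V) /\ (@oproj _ _ _ d @` V) (oproj x0)].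
Proof.
move=> mn Px0 psiP.
have [E [[oE Ex0] _ Epsi EP starE]] :=
  good_nbhd (oact_smooth c) spsi psix0 openT I.
pose d : orbifold_chart R n O := small_chart spsi oE Ex0 Epsi EP starE.
pose kappa := sub_chart oE Ex0 Epsi.
pose V : set E := [set y : E | forall i : 'I_n, (m <= i)%N ->
  cmap psi (set_val y) ord0 i = 0].
(* So [V] is the entire preimage of [P] in the small chart. This gives its invariance under the
   group and the openness of its image in [P], with [obase d] as the open set. *)
have VP (y : E) : V y <-> P (oproj (set_val y)).
  by apply: iff_sym; apply: psiP; exact/Epsi/set_valP.
have Vx0 : V (sub_point Ex0 x0) by apply/VP; rewrite sub_pointK.
exists d, [set: ogroup d]%G, V; split.
- exact: small_chart_atlas.
- split=> [y Vy|h y _ /VP Py|h y _ _]; last by rewrite inE.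
    split=> //; exists kappa; split=> //.
    exact: sub_chart_smooth.
  apply/VP.
  have -> : oproj (set_val (oact (o := d) h y)) = oproj (set_val y) :> O.
    exact: (oproj_invariant (o := d) h y).
  exact: Py.
- split.
    (* The last coordinates vanish at the center as well, hence on the whole ray, so the star-shape
       of [E] passes to the slice. *)
    apply: (@star_connected _ _ _ kappa _ (sub_point Ex0 x0)) => // y t Vy t01.
    have [z Ez zE] := starE _ _ (set_valP y) t01.
    exists (sub_point Ex0 z); last by rewrite /= !sub_pointK.
    move=> i mi; rewrite sub_pointK// zE /ray !mxE (Vy i mi).
    have := Vx0 i mi; rewrite sub_pointK// => ->.
    by rewrite subrr mulr0 addr0.
  have -> : V = \bigcap_(i in [set i : 'I_n | (m <= i)%N])
      ((fun y : E => cmap psi (set_val y) ord0 i) @^-1` [set 0]).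
    by apply/seteqP; split.
  apply: closed_bigI => i _; apply: closed_comp; last exact: closed_eq.
  move=> y _; apply: (@continuous_comp _ _ _ (cmap kappa)
    (fun v : 'rV[R]_n => v ord0 i)); last exact: coord_continuous.
  exact: cmap_continuous.
- split; last by exists (sub_point Ex0 x0) => //=; rewrite /small_proj sub_pointK.
  exists (obase d); first exact: obase_open.
  apply/seteqP; split=> [_ [y Vy <-]|q [Pq [z Ez zq]]].
    by split; [exact/VP|exact: (oproj_base (c := d) y)].
  exists (sub_point Ex0 z); last by rewrite /= /small_proj sub_pointK.
  by apply/VP; rewrite sub_pointK// zq.
Qed.

End LinearSlice.

Theorem theorem6p3 (R : realType) (n : nat) (O : orbifold R n) (k1 k2 : int)
    (P1 P2 : set O) :
  full_suborbifold k1 P1 ->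
  full_suborbifold k2 P2 ->
  transverse_suborbifolds P1 P2 ->
  full_suborbifold (k1 + k2 - n%:Z) (P1 `&` P2).
Proof.
move=> fP1 fP2 tP p [P1p P2p].
have [c [D1 [D2 [n1 [n2 [V1 [V2 [ac _ [oV1 oV2] tV [x [V1x V2x xp]]]]]]]]]] :=
  tP p P1p P2p.
have [phi aphi xphi] := matlas_cover x.
have sphi := matlas_smooth_chart aphi.
rewrite -xp in P1p P2p *.
have [m1 [k1E m1n] [B1 [F1 [[oB1 B1x] _ sF1 iF1 F1P]]]] :=
  suborbifold_equations fP1 ac P1p sphi xphi.
have [m2 [k2E m2n] [B2 [F2 [[oB2 B2x] _ sF2 iF2 F2P]]]] :=
  suborbifold_equations fP2 ac P2p sphi xphi.
have VP (V : set (ocover c)) (P : set O) z :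
    open_in P (@oproj _ _ _ c @` V) -> V z -> P (oproj z).
  move=> [W _ VW] Vz; suff [] : (P `&` W) (oproj z) by [].
  by rewrite -VW; exists z.
have transv (w : 'rV[R]_n) : exists v1 v2,
    [/\ forall i : 'I_n, (m1 <= i)%N -> (v1 *m 'J F1 (cmap phi x)) ord0 i = 0,
        forall i : 'I_n, (m2 <= i)%N -> (v2 *m 'J F2 (cmap phi x)) ord0 i = 0 &
        w = v1 + v2].
  have [v1 [v2 [v1V v2V wE]]] := tV x phi V1x V2x aphi xphi w.
  exists v1, v2; split=> // i mi.
    apply: (tangent_space_kernel v1V oB1 B1x sF1) => z V1z zphi B1z.
    by apply: ((F1P _ B1z).1 _ i mi); rewrite cmapK//; exact: VP oV1 V1z.
  apply: (tangent_space_kernel v2V oB2 B2x sF2) => z V2z zphi B2z.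
  by apply: ((F2P _ B2z).1 _ i mi); rewrite cmapK//; exact: VP oV2 V2z.
have uJ1 := (jacobian_unit F1 (cmap phi x)).1 iF1.
have uJ2 := (jacobian_unit F2 (cmap phi x)).1 iF2.
have [m [K [T1 [T2 [mE mn uQ QP]]]]] := transverse_equations m1n m2n uJ1 uJ2 transv.
(* By [QP] the last [n - m] components of [f] vanish exactly where both systems of equations hold,
   and [uQ] says that its Jacobian at the point is invertible. *)
pose f y := y *m K + F1 y *m T1 + F2 y *m T2.
have sid := smooth_at_id (cmap phi x).
have sf : smooth_at f (cmap phi x).
  apply: smooth_atD; last exact: smooth_at_mulmx.
  by apply: smooth_atD; exact: smooth_at_mulmx.
have Jf : 'J f (cmap phi x) =
    K + 'J F1 (cmap phi x) *m T1 + 'J F2 (cmap phi x) *m T2.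
  have sK := smooth_at_mulmx K sid.
  have s1 := smooth_at_mulmx T1 sF1; have s2 := smooth_at_mulmx T2 sF2.
  have dK := smooth_at_differentiable sK.
  have d1 := smooth_at_differentiable s1; have d2 := smooth_at_differentiable s2.
  have dK1 := smooth_at_differentiable (smooth_atD sK s1).
  rewrite (jacobianD dK1 d2) (jacobianD dK d1) !jacobian_mulmx//.
  by rewrite jacobian_id mul1mx.
have iF : injective ('d f (cmap phi x)) by apply/jacobian_unit; rewrite Jf.
have nB : nbhs (cmap phi x) (B1 `&` B2).
  by apply: filterI; exact: open_nbhs_nbhs.
have [psi [spsi xpsi psiP]] := local_diffeo_chart sphi xphi nB sf iF.
have kE : k1 + k2 - n%:Z = m%:Z by rewrite k1E k2E; lia.
have [||d [D [V [ad fV ccV oV]]]] :=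
  linear_slice_suborbifold ac spsi xpsi mn (P := P1 `&` P2).
- by [].
- move=> z zpsi; have [zphi [B1z B2z] ->] := psiP z zpsi.
  rewrite /f; apply: iff_trans (iff_sym (QP _ _ _)).
  have e1 := F1P _ B1z; have e2 := F2P _ B2z.
  rewrite cmapK// in e1; rewrite cmapK// in e2.
  by split=> [[/e1 ? /e2 ?]|[/e1 ? /e2 ?]].
by exists d, D, m, V.
Qed.
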